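(* Let $n\ge 2$ and let $\{K_j\}_{j=1}^\infty\subset\mathcal K(\mathbb H^n)$ and $K\in\mathcal K(\mathbb H^n)$ be such that $K_j\to K$ as $j\to\infty$ in the Hausdorff distance. Then for every $r=0,\dots,n-1$, $$\Phi_r(K_j,\cdot)\to\Phi_r(K,\cdot)\qquad\text{as } j\to\infty,$$ weakly in the sense of measures on $\mathbb H^n$.
   Context: $\mathbb H^n$ is the real $n$-dimensional hyperbolic space (constant curvature $-1$), with distance $\mathrm d_{\mathbb H^n}$ and Riemannian volume $\mathrm{Vol}_{\mathbb H^n}$. $\mathcal K(\mathbb H^n)$ is the set of compact (geodesically) convex subsets of $\mathbb H^n$ with nonempty interior. The Hausdorff distance is $\mathrm{dist}_{\mathcal H}(K,L)=\inf\{\lambda>0: K\subset B_\lambda(L),\ L\subset B_\lambda(K)\}$ with $B_\lambda(L)=\{q\in\mathbb H^n:\mathrm d_{\mathbb H^n}(q,L)<\lambda\}$. For $K\in\mathcal K(\mathbb H^n)$, $f_K:\mathbb H^n\setminus K\to\partial K$ is the nearest-point projection, i.e. $\mathrm d_{\mathbb H^n}(f_K(x),x)=\mathrm d_{\mathbb H^n}(x,K)$. For $\rho>0$, $K_\rho=\{x:\mathrm d_{\mathbb H^n}(x,K)\le\rho\}$, and for a Borel set $\beta\subset\mathbb H^n$, $$M_\rho(K,\beta)=f_K^{-1}(\beta\cap\partial K)\cap(K_\rho\setminus K),\qquad \mu_\rho(K,\beta)=\mathrm{Vol}_{\mathbb H^n}(M_\rho(K,\beta)).$$ Kohlmann's curvature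 measures $\Phi_0(K,\cdot),\dots,\Phi_{n-1}(K,\cdot)$ are the finite Borel measures on $\mathbb H^n$ (known to exist, by a theorem of Kohlmann) determined by the Steiner-type formula $$\mu_\rho(K,\beta)=\sum_{r=0}^{n-1}\ell_{n-r}(\rho)\,\Phi_r(K,\beta)\quad\text{for all }\rho>0\text{ and all Borel }\beta\subset\mathbb H^n,$$ where $\ell_{n-r}(t)=\int_0^t\sinh^{n-1-r}(x)\cosh^{r}(x)\,dx$. Weak convergence of measures $\mu_j\to\mu$ means $\int\varphi\,d\mu_j\to\int\varphi\,d\mu$ for every bounded continuous $\varphi:\mathbb H^n\to\mathbb R$. *)

(* Defs.v *)
From HB Require Import structures.
From mathcomp Require Import all_boot all_order all_algebra.
From mathcomp Require Import all_classical all_reals all_analysis.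
From mathcomp Require Import ring lra.
Set Implicit Arguments.
Unset Strict Implicit.
Unset Printing Implicit Defensive.
Import Order.TTheory GRing.Theory Num.Theory.
Import numFieldNormedType.Exports.
Local Open Scope classical_set_scope.
Local Open Scope ring_scope.

Section hyperbolic_functions.
Context {R : realType}.
Implicit Types x : R.

Definition sinh x : R := (expR x - expR (- x)) / 2.
Definition cosh x : R := (expR x + expR (- x)) / 2.
Definition arcosh x : R := ln (x + Num.sqrt (x ^+ 2 - 1)).

End hyperbolic_functions.

Section minkowski.
Context {R : realType} {n : nat}.
Implicit Types (x y z u v : 'rV[R]_n.+1) (a b c t : R).

(* Lorentzian form of signature (n, 1); coordinate 0 is the time coordinate. *)
Definition minkowski x y : R :=
  \sum_(i < n) x 0 (lift ord0 i) * y 0 (lift ord0 i) - x 0 0 * y 0 0.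

Definition on_hyperboloid x : bool := (minkowski x x == -1) && (0 < x 0 0).

Lemma minkowskiC x y : minkowski x y = minkowski y x.
Proof.
by rewrite /minkowski mulrC; congr (_ - _); apply: eq_bigr => i _; rewrite mulrC.
Qed.

Lemma minkowskiDZ t x y z :
  minkowski (x + t *: y) z = minkowski x z + t * minkowski y z.
Proof.
rewrite /minkowski mulrBr mulr_sumr addrACA -big_split/= !mxE mulrDl opprD mulrA.
by congr (_ + _); apply: eq_bigr => i _; rewrite !mxE mulrDl mulrA.
Qed.

Lemma minkowskiDZr t x y z :
  minkowski z (x + t *: y) = minkowski z x + t * minkowski z y.
Proof. by rewrite minkowskiC minkowskiDZ !(minkowskiC z). Qed.

Lemma discriminant_le a b c : 0 <= a -> 0 <= c ->
  (forall t, 0 <= a + (2 * b) * t + c * t ^+ 2) -> b ^+ 2 <= a * c.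
Proof.
move=> a0 c0 h; have [c_gt0|] := ltP 0 c.
  have := h (- b / c); rewrite (_ : _ + _ = (a * c - b ^+ 2) / c); last first.
    by field; rewrite gt_eqF.
  by rewrite pmulr_lge0 ?invr_gt0// subr_ge0.
move=> c0'; have cE : c = 0 by apply/eqP; rewrite eq_le c0 c0'.
rewrite cE mulr0; have [->|b0] := eqVneq b 0; first by rewrite expr0n.
have := h (- (a + 1) / (2 * b)); rewrite cE.
rewrite (_ : _ + _ = -1); last by field.
by rewrite oppr_ge0 ler10.
Qed.

Lemma cauchy_schwarz_sum (f g : 'I_n -> R) :
  (\sum_i f i * g i) ^+ 2 <= (\sum_i f i ^+ 2) * (\sum_i g i ^+ 2).
Proof.
apply: discriminant_le; [exact/sumr_ge0/(fun i _ => sqr_ge0 _)..|move=> t].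
have -> : \sum_i f i ^+ 2 + 2 * (\sum_i f i * g i) * t +
    (\sum_i g i ^+ 2) * t ^+ 2 = \sum_i (f i + t * g i) ^+ 2.
  rewrite mulr_sumr !mulr_suml -!big_split/=.
  by apply: eq_bigr => i _; ring.
by apply: sumr_ge0 => i _; exact: sqr_ge0.
Qed.

Let space x : R := \sum_(i < n) x 0 (lift ord0 i) ^+ 2.

Let minkowskixx x : minkowski x x = space x - x 0 0 ^+ 2.
Proof.
by rewrite /minkowski expr2; congr (_ - _); apply: eq_bigr => i _; rewrite expr2.
Qed.

Let space_ge0 x : 0 <= space x.
Proof. by apply: sumr_ge0 => i _; exact: sqr_ge0. Qed.

Let space_hyperboloid x : on_hyperboloid x -> space x = x 0 0 ^+ 2 - 1.
Proof. by move=> /andP[/eqP + _]; rewrite minkowskixx; lra. Qed.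

Let orthogonal_time u y : on_hyperboloid y -> minkowski u y = 0 ->
  u 0 0 ^+ 2 * y 0 0 ^+ 2 <= space u * (y 0 0 ^+ 2 - 1).
Proof.
move=> hy /eqP; rewrite subr_eq0 => /eqP uy.
rewrite -space_hyperboloid// -exprMn -uy; exact: cauchy_schwarz_sum.
Qed.

Let orthogonal_ge0 u y : on_hyperboloid y -> minkowski u y = 0 ->
  0 <= minkowski u u.
Proof.
move=> hy uy; rewrite minkowskixx subr_ge0.
have y0 : 0 < y 0 0 ^+ 2 by rewrite exprn_gt0//; case/andP: hy.
rewrite -(ler_pM2r y0); apply: (le_trans (orthogonal_time hy uy)).
by rewrite ler_wpM2l// lerBlDr lerDl.
Qed.

Let orthogonal_eq0 u y : on_hyperboloid y -> minkowski u y = 0 ->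
  minkowski u u = 0 -> u = 0.
Proof.
move=> hy uy uu; have := orthogonal_time hy uy.
have su : space u = u 0 0 ^+ 2 by apply/eqP; rewrite -subr_eq0 -minkowskixx uu.
rewrite su mulrBr mulr1 lerDl oppr_ge0 => u0.
have {}u0 : u 0 0 ^+ 2 = 0 by apply/eqP; rewrite eq_le u0 sqr_ge0.
move: su; rewrite u0 => /eqP; rewrite psumr_eq0 => [/allP u'|i _]; last exact: sqr_ge0.
apply/rowP => j; rewrite mxE; have [i ->|->] := unliftP ord0 j.
  by have /= := u' i (mem_index_enum i); rewrite sqrf_eq0 => /eqP.
by apply/eqP; rewrite -sqrf_eq0 u0.
Qed.

Lemma minkowski_hyperboloid x y : on_hyperboloid x -> on_hyperboloid y ->
  1 <= - minkowski x y.
Proof.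
move=> hx hy; have x0 := (andP hx).2; have y0 := (andP hy).2.
have xx : minkowski x x = -1 by apply/eqP; case/andP: hx.
have yy : minkowski y y = -1 by apply/eqP; case/andP: hy.
pose c := - minkowski x y.
have xy : minkowski (x + (- c) *: y) y = 0.
  by rewrite minkowskiDZ yy /c; ring.
have h : 0 <= c ^+ 2 - 1.
  rewrite (_ : _ - _ = minkowski (x + - c *: y) (x + - c *: y)).
    exact: orthogonal_ge0 hy xy.
  by rewrite minkowskiDZr xy minkowskiDZ xx (minkowskiC y x) /c; ring.
rewrite -/c.
have c0 : 0 <= c.
  rewrite /c /minkowski opprB subr_ge0.
  apply: le_trans (ler_norm _) _; rewrite -ler_sqr ?nnegrE ?mulr_ge0 ?(ltW x0) ?(ltW y0)//.
  rewrite real_normK ?num_real//; apply: (le_trans (cauchy_schwarz_sum _ _)).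
  rewrite -!/(space _) !space_hyperboloid// exprMn.
  have := space_ge0 x; have := space_ge0 y.
  rewrite !space_hyperboloid// !subr_ge0 => y1 x1.
  by nra.
by rewrite -(@ler_sqr _ 1) ?nnegrE// expr1n; lra.
Qed.

Lemma minkowski_eqN1 x y : on_hyperboloid x -> on_hyperboloid y ->
  minkowski x y = -1 -> x = y.
Proof.
move=> hx hy xy.
have xx : minkowski x x = -1 by apply/eqP; case/andP: hx.
have yy : minkowski y y = -1 by apply/eqP; case/andP: hy.
have uy : minkowski (x + (-1) *: y) y = 0 by rewrite minkowskiDZ xy yy; ring.
have /eqP : x + (-1) *: y = 0.
  apply: (orthogonal_eq0 hy uy).
  by rewrite minkowskiDZr uy minkowskiDZ xx minkowskiC xy; ring.
by rewrite scaleN1r subr_eq0 => /eqP.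
Qed.

Lemma minkowski_triangle x y z :
  on_hyperboloid x -> on_hyperboloid y -> on_hyperboloid z ->
  let a := - minkowski x y in let b := - minkowski y z in
  - minkowski x z <= a * b + Num.sqrt (a ^+ 2 - 1) * Num.sqrt (b ^+ 2 - 1).
Proof.
move=> hx hy hz; set a := - minkowski x y; set b := - minkowski y z => /=.
have xx : minkowski x x = -1 by apply/eqP; case/andP: hx.
have yy : minkowski y y = -1 by apply/eqP; case/andP: hy.
have zz : minkowski z z = -1 by apply/eqP; case/andP: hz.
have xy : minkowski x y = - a by rewrite opprK.
have yz : minkowski y z = - b by rewrite opprK.
pose u := x + (- a) *: y; pose v := z + (- b) *: y.
have uy : minkowski u y = 0 by rewrite minkowskiDZ xy yy; ring.
have vy : minkowski v y = 0 by rewrite minkowskiDZ (minkowskiC z) yz yy; ring.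
have uu : minkowski u u = a ^+ 2 - 1.
  by rewrite {2}/u minkowskiDZr uy minkowskiDZ xx minkowskiC xy; ring.
have vv : minkowski v v = b ^+ 2 - 1.
  by rewrite {2}/v minkowskiDZr vy minkowskiDZ zz yz; ring.
have uv : minkowski u v = minkowski x z + a * b.
  by rewrite {1}/v minkowskiDZr uy minkowskiDZ yz; ring.
have uu0 : 0 <= a ^+ 2 - 1 by rewrite -uu; exact: orthogonal_ge0 hy uy.
have vv0 : 0 <= b ^+ 2 - 1 by rewrite -vv; exact: orthogonal_ge0 hy vy.
have : minkowski u v ^+ 2 <= (a ^+ 2 - 1) * (b ^+ 2 - 1).
  apply: discriminant_le => // t.
  have <- : minkowski (u + t *: v) (u + t *: v) =
      a ^+ 2 - 1 + 2 * minkowski u v * t + (b ^+ 2 - 1) * t ^+ 2.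
    by rewrite minkowskiDZr (minkowskiDZ t u v u) (minkowskiDZ t u v v) uu vv
      (minkowskiC v u); ring.
  by apply: (orthogonal_ge0 hy); rewrite minkowskiDZ uy vy mulr0 addr0.
rewrite -ler_sqrt ?mulr_ge0// sqrtr_sqr sqrtrM// => h.
have : - minkowski u v <= Num.sqrt (a ^+ 2 - 1) * Num.sqrt (b ^+ 2 - 1).
  by apply: le_trans h; rewrite -normrN ler_norm.
by rewrite uv; lra.
Qed.

End minkowski.

Section arcosh_theory.
Context {R : realType}.
Implicit Types a b c : R.

Let sqr_ge1 a : 1 <= a -> 0 <= a ^+ 2 - 1.
Proof. by move=> a1; nra. Qed.

Lemma arcosh1 : arcosh (1 : R) = 0.
Proof. by rewrite /arcosh expr1n subrr sqrtr0 addr0 ln1. Qed.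

Lemma arcosh_eq0 a : 1 <= a -> arcosh a = 0 -> a = 1.
Proof.
move=> a1 /eqP; rewrite /arcosh ln_eq0; last first.
  by rewrite ltr_wpDr ?sqrtr_ge0// (lt_le_trans ltr01).
by move=> /eqP; have := sqrtr_ge0 (a ^+ 2 - 1); lra.
Qed.

Lemma arcosh_triangle a b c : 1 <= a -> 1 <= b -> 1 <= c ->
  c <= a * b + Num.sqrt (a ^+ 2 - 1) * Num.sqrt (b ^+ 2 - 1) ->
  arcosh c <= arcosh a + arcosh b.
Proof.
move=> a1 b1 c1; rewrite /arcosh.
set s := Num.sqrt (a ^+ 2 - 1); set t := Num.sqrt (b ^+ 2 - 1) => h.
have s0 : 0 <= s by exact: sqrtr_ge0.
have t0 : 0 <= t by exact: sqrtr_ge0.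
have s2 : s ^+ 2 = a ^+ 2 - 1 by rewrite sqr_sqrtr// sqr_ge1.
have t2 : t ^+ 2 = b ^+ 2 - 1 by rewrite sqr_sqrtr// sqr_ge1.
rewrite -lnM ?posrE; [|by lra..].
rewrite ler_ln ?posrE; last 2 first.
- by have := sqrtr_ge0 (c ^+ 2 - 1); lra.
- by apply: mulr_gt0; lra.
have -> : (a + s) * (b + t) = (a * b + s * t) + (a * t + b * s) by ring.
apply: lerD => //.
have r0 : 0 <= a * t + b * s by rewrite addr_ge0// mulr_ge0//; lra.
rewrite -(ger0_norm r0) -sqrtr_sqr ler_sqrt ?sqr_ge0//.
have -> : (a * t + b * s) ^+ 2 = (a * b + s * t) ^+ 2 - 1.
  transitivity (a ^+ 2 * t ^+ 2 + b ^+ 2 * s ^+ 2 + 2 * (a * b * s * t)).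
    by ring.
  transitivity (a ^+ 2 * b ^+ 2 + s ^+ 2 * t ^+ 2 + 2 * (a * b * s * t) - 1).
    by rewrite s2 t2; ring.
  by ring.
by rewrite lerD2r ler_sqr ?nnegrE//; nra.
Qed.

End arcosh_theory.

(* Hyperboloid model of real hyperbolic n-space: the upper sheet of
   <x, x> = -1 in R^(n,1), with cosh d(p, q) = - <p, q>. *)
Record hyperbolic (R : realType) (n : nat) := Hyperbolic {
  hyperbolic_val :> 'rV[R]_n.+1 ;
  hyperbolicP : on_hyperboloid hyperbolic_val }.

Section hyperbolic_space.
Context {R : realType} {n : nat}.
Notation H := (hyperbolic R n).
Implicit Types p q x y : H.

HB.instance Definition _ := [isSub for @hyperbolic_val R n].
HB.instance Definition _ := [Choice of H by <:].

Definition hyp_dist p q : R := arcosh (- minkowski p q).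

Let hyp_distxx p : hyp_dist p p = 0.
Proof.
rewrite /hyp_dist; have /andP[/eqP -> _] := hyperbolicP p.
by rewrite opprK arcosh1.
Qed.

Let hyp_dist_eq0 p q : hyp_dist p q = 0 -> p = q.
Proof.
have hp := hyperbolicP p; have hq := hyperbolicP q.
move=> /(arcosh_eq0 (minkowski_hyperboloid hp hq)) pq.
by apply/val_inj/minkowski_eqN1 => //; rewrite -pq opprK.
Qed.

Let hyp_dist_sym p q : hyp_dist p q = hyp_dist q p.
Proof. by rewrite /hyp_dist minkowskiC. Qed.

Let hyp_dist_triangle q p x : hyp_dist p x <= hyp_dist p q + hyp_dist q x.
Proof.
have hp := hyperbolicP p; have hq := hyperbolicP q; have hx := hyperbolicP x.
apply: arcosh_triangle; try exact: minkowski_hyperboloid.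
exact: minkowski_triangle.
Qed.

HB.instance Definition _ := isMetric.Build R H
  hyp_distxx hyp_dist_eq0 hyp_dist_sym hyp_dist_triangle.

Implicit Type u : n.-tuple R.

(* Global chart of the hyperboloid: its graph over R^n. *)
Definition hyp_height u : R := Num.sqrt (1 + \sum_(i < n) tnth u i ^+ 2).

Definition hyp_graph u : 'rV[R]_n.+1 :=
  \row_j (if unlift ord0 j is Some i then tnth u i else hyp_height u).

Lemma hyp_graphP u : on_hyperboloid (hyp_graph u).
Proof.
have s0 : 0 <= \sum_(i < n) tnth u i ^+ 2.
  by apply: sumr_ge0 => i _; exact: sqr_ge0.
have h2 : hyp_height u ^+ 2 = 1 + \sum_(i < n) tnth u i ^+ 2.
  by rewrite sqr_sqrtr// addr_ge0.
apply/andP; split; last first.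
  by rewrite mxE unlift_none /hyp_height sqrtr_gt0 ltr_wpDr.
rewrite /minkowski (eq_bigr (fun i => tnth u i ^+ 2)); last first.
  by move=> i _; rewrite mxE liftK expr2.
rewrite !mxE unlift_none -expr2 h2; apply/eqP; ring.
Qed.

Definition hyp_chart u : H := Hyperbolic (hyp_graphP u).

HB.instance Definition _ := isPointed.Build H (hyp_chart [tuple of nseq n 0]).

(* The Borel sigma-algebra. *)
HB.instance Definition _ := @isMeasurable.Build (sigma_display (@open H)) H
  <<s @open H >> (@sigma_algebra0 _ setT (@open H))
  (@sigma_algebraC H (@open H)) (@sigma_algebra_bigcup _ setT (@open H)).

End hyperbolic_space.

Section lebesgue_cons.
Context {R : realType} {n : nat}.
Local Open Scope ereal_scope.
Notation Rm := (measurableTypeR R).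
Variable mu : {sigma_finite_measure set (n.-tuple Rm) -> \bar R}.

Let cons_pair (p : Rm * n.-tuple Rm) : n.+1.-tuple Rm :=
  [the n.+1.-tuple Rm of p.1 :: p.2].

Definition lebesgue_cons : set (n.+1.-tuple Rm) -> \bar R :=
  pushforward (@lebesgue_measure R \x mu) cons_pair.

Let measurable_cons_pair : measurable_fun [set: Rm * n.-tuple Rm] cons_pair.
Proof. exact: measurable_cons. Qed.

Let lebesgue_cons0 : lebesgue_cons set0 = 0.
Proof. by rewrite /lebesgue_cons /pushforward preimage_set0 measure0. Qed.

Let lebesgue_cons_ge0 A : 0 <= lebesgue_cons A.
Proof. exact: measure_ge0. Qed.

Let lebesgue_cons_sigma_additive : semi_sigma_additive lebesgue_cons.
Proof.
exact: (@measure_semi_sigma_additive _ _ _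
  (measure_function_pushforward__canonical__measure_function_Measure
    (@lebesgue_measure R \x mu) measurable_cons_pair)).
Qed.

HB.instance Definition _ := isMeasure.Build _ _ _ lebesgue_cons
  lebesgue_cons0 lebesgue_cons_ge0 lebesgue_cons_sigma_additive.

Let product_sigma_finite : sigma_finite setT (@lebesgue_measure R \x mu).
Proof.
have /sigma_finiteP[F [TF ndF Foo]] := sigma_finiteT (@lebesgue_measure R).
have /sigma_finiteP[G [TG ndG Goo]] := sigma_finiteT mu.
exists (fun k => F k `*` G k).
  rewrite -setXTT TF TG predeqE => -[x y]; split; last first.
    by move=> [k _ []/= ? ?]; split; exists k.
  move=> [/= [k _ Fkx] [l _ Gly]]; exists (maxn k l) => //; split.
  - by move: x Fkx; exact/subsetPset/ndF/leq_maxl.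
  - by move: y Gly; exact/subsetPset/ndG/leq_maxr.
move=> k; have [? ?] := Foo k; have [? ?] := Goo k.
split; first exact: measurableX.
by rewrite product_measure1E// lte_mul_pinfty// ge0_fin_numE.
Qed.

Let lebesgue_cons_sigma_finite : sigma_finite setT lebesgue_cons.
Proof.
have [F TF Foo] := product_sigma_finite.
pose split_tuple (t : n.+1.-tuple Rm) : Rm * n.-tuple Rm :=
  (tnth t ord0, [tuple of behead t]).
have msplit : measurable_fun setT split_tuple.
  by apply/measurable_fun_pairP; split => /=;
    [exact: measurable_tnth|exact: measurable_behead].
exists (fun k => split_tuple @^-1` F k).
  by rewrite -preimage_bigcup -TF preimage_setT.
move=> k; have [mF Fk] := Foo k; split.
  by rewrite -[X in measurable X]setTI; exact: msplit.
rewrite /lebesgue_cons /pushforward (_ : _ @^-1` _ = F k)//.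
rewrite -comp_preimage (_ : split_tuple \o cons_pair = idfun)//.
apply/funext => -[a t]; congr pair; exact/val_inj.
Qed.

HB.instance Definition _ := Measure_isSigmaFinite.Build _ _ _ lebesgue_cons
  lebesgue_cons_sigma_finite.

End lebesgue_cons.

(* n-dimensional Lebesgue measure, as an iterated product measure. *)
Fixpoint lebesgue_tuple (R : realType) (n : nat) :
    {sigma_finite_measure set (n.-tuple (measurableTypeR R)) -> \bar R} :=
  match n with
  | 0 => [the sigma_finite_measure _ _ of dirac [tuple]]
  | n'.+1 => [the sigma_finite_measure _ _ of lebesgue_cons (lebesgue_tuple R n')]
  end.

Section hyperbolic_volume.
Context {R : realType} {n : nat}.
Notation H := (hyperbolic R n).
Implicit Type u : n.-tuple R.

(* [hyp_tangent u i] is the i-th partial derivative of [hyp_graph] at [u]. *)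
Definition hyp_tangent u (i : 'I_n) : 'rV[R]_n.+1 :=
  \row_k (if unlift ord0 k is Some j then (j == i)%:R
          else tnth u i / hyp_height u).

(* Matrix of the Riemannian metric in the chart: the Lorentzian form
   restricted to the tangent spaces of the hyperboloid. *)
Definition hyp_metric u : 'M[R]_n :=
  \matrix_(i, j) minkowski (hyp_tangent u i) (hyp_tangent u j).

Definition hyp_vol (A : set H) : \bar R :=
  (\int[lebesgue_tuple R n]_(u in hyp_chart @^-1` A)
     (Num.sqrt (\det (hyp_metric u)))%:E)%E.

End hyperbolic_volume.

Section metric_notions.
Context {R : realType} {T : metricType R}.
Implicit Types (K L : set T) (x p q : T).

Definition boundary K : set T := closure K `\` K°.

Definition dist_set x K : R := inf [set mdist x p | p in K].

Definition open_nbhd (lambda : R) L : set T := [set q | dist_set q L < lambda].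

Definition hausdorff_dist K L : R :=
  inf [set lambda | [/\ 0 < lambda, K `<=` open_nbhd lambda L &
                                    L `<=` open_nbhd lambda K]].

(* Unit-speed parametrisation of a minimising geodesic segment. *)
Definition geodesic_segment (l : R) (gamma : R -> T) : Prop :=
  forall s t, s \in `[0, l] -> t \in `[0, l] ->
    mdist (gamma s) (gamma t) = `|s - t|.

Definition geodesically_convex K : Prop :=
  forall (l : R) (gamma : R -> T), 0 <= l -> geodesic_segment l gamma ->
    K (gamma 0) -> K (gamma l) -> forall t, t \in `[0, l] -> K (gamma t).

Definition convex_body K : Prop :=
  [/\ compact K, geodesically_convex K & K° !=set0].

(* Only meaningful for [x] outside a convex body [K]. *)
Definition nearest_point K x : T :=
  xget x [set p | boundary K p /\ mdist p x = dist_set x K].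

Definition parallel_body K (rho : R) : set T := [set x | dist_set x K <= rho].

(* M_rho(K, beta); subtracting [K] also restricts the preimage to the domain
   of the projection. *)
Definition local_parallel_set K (rho : R) (beta : set T) : set T :=
  (nearest_point K @^-1` (beta `&` boundary K)) `&` (parallel_body K rho `\` K).

End metric_notions.

(* l_{n-r}(t) *)
Definition steiner_coef {R : realType} (n r : nat) (t : R) : R :=
  \int[@lebesgue_measure R]_(x in `[0, t]) (sinh x ^+ (n.-1 - r) * cosh x ^+ r).

Section curvature_measures.
Context {R : realType} {n : nat}.
Notation H := (hyperbolic R n).

(* mu_rho(K, beta) *)
Definition local_parallel_vol (K : set H) (rho : R) (beta : set H) : \bar R :=
  hyp_vol (local_parallel_set K rho beta).

(* Steiner-type formula. The functions [steiner_coef n r], r < n, are linearly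
   independent on ]0, +oo[, so it determines the values of [Phi] on Borel sets. *)
Definition curvature_measures (K : set H)
    (Phi : 'I_n -> {finite_measure set H -> \bar R}) : Prop :=
  forall (rho : R) (beta : set H), 0 < rho -> measurable beta ->
    (local_parallel_vol K rho beta =
     \sum_(r < n) (steiner_coef n r rho)%:E * Phi r beta)%E.

Definition weak_cvg (mu_ : nat -> {finite_measure set H -> \bar R})
    (mu : {finite_measure set H -> \bar R}) : Prop :=
  forall phi : H -> R, continuous phi -> bounded_fun phi ->
    (\int[mu_ j]_x (phi x)%:E @[j --> \oo] --> \int[mu]_x (phi x)%:E)%E.

End curvature_measures.

(* Main.v *)
From HB Require Import structures.
Require Import Defs.
From mathcomp Require Import all_boot all_order all_algebra.
From mathcomp Require Import all_classical all_reals all_analysis.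
From mathcomp Require Import measurable_realfun.
From mathcomp Require Import ring lra zify.
Set Implicit Arguments.
Unset Strict Implicit.
Unset Printing Implicit Defensive.
Import Order.TTheory GRing.Theory Num.Theory.
Import numFieldNormedType.Exports.
Local Open Scope classical_set_scope.
Local Open Scope ring_scope.

(** Integrating a continuous [phi] against the Steiner formula expresses the
    integral of [phi] composed with the nearest-point projection, over the points
    at distance more than [a] and at most [b] from [K], as the combination of
    the integrals of [phi] against the curvature measures whose coefficients are
    the increments of the Steiner coefficients between [a] and [b]
    ([annulus_integral]). Two facts then give the theorem.

    The volume integrals converge when [K_ j] tends to [K]
    ([annulus_integral_cvg]). Distances to a set are stable under Hausdorff
    perturbations, and so are nearest points. Indeed, if [p] is nearest to [x] in
    [K], if [q] is another point of [K] and [m] is the midpoint of [p] and [q],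
    then [m] is not closer to [x] than [p]. In the hyperboloid model,
    [2 * cosh (d(p, q) / 2) * cosh d(x, m) = cosh d(x, p) + cosh d(x, q)]
    ([midpoint]), so [q] is close to [p] as soon as [d(x, q)] is close to
    [d(x, p)] ([nearest_point_stable]). Integrands and domains therefore
    converge pointwise away from two level sets of the distance to [K]. These
    have volume zero because the Steiner coefficients depend continuously on the
    radius ([hyp_vol_level_set]), and dominated convergence applies.

    The relations for all [0 < a < b] determine the individual terms. A linear
    relation between the increments of the Steiner coefficients would, after
    differentiation, be one between the functions
    [sinh ^+ (n - 1 - r) * cosh ^+ r], that is, a nonzero polynomial vanishing
    at all positive values of the hyperbolic tangent ([steiner_coef_free]). So the
    vectors of increments span, and convergence of all their combinations
    implies convergence of each term ([separated_subspace_full]).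

    Measurability of the projection is continuity, a case of the same stability
    estimate, and the volume is a measure because the global chart is
    Borel ([measurable_hyp_chart]). *)

(* The imported analysis files also define a [minkowski]. *)
Local Notation minkowski := Defs.minkowski.

(** * Hyperbolic trigonometry *)

Section hyperbolic_trigonometry.
Context {R : realType}.
Implicit Types x y a t : R.

Lemma coshN x : cosh (- x) = cosh x.
Proof. by rewrite /cosh opprK addrC. Qed.

Lemma sinhN x : sinh (- x) = - sinh x.
Proof. by rewrite /sinh opprK -mulNr opprB. Qed.

Lemma cosh0 : cosh (0 : R) = 1.
Proof. by rewrite /cosh oppr0 expR0; lra. Qed.

Lemma cosh2_sinh2 x : cosh x ^+ 2 - sinh x ^+ 2 = 1.
Proof.
have := expRxMexpNx_1 x; rewrite /cosh /sinh.
by move: (expR x) (expR (- x)) => e f; nra.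
Qed.

Lemma coshB x y : cosh (x - y) = cosh x * cosh y - sinh x * sinh y.
Proof.
rewrite /cosh /sinh opprB addrC !expRD.
by move: (expR x) (expR y) (expR (- x)) (expR (- y)) => a b c d; field.
Qed.

Lemma sinh0 : sinh (0 : R) = 0.
Proof. by rewrite /sinh oppr0 subrr mul0r. Qed.

Lemma sinhB x y : sinh (x - y) = sinh x * cosh y - cosh x * sinh y.
Proof.
rewrite /cosh /sinh opprB addrC !expRD.
by move: (expR x) (expR y) (expR (- x)) (expR (- y)) => a b c d; field.
Qed.

Lemma cosh_ge1 x : 1 <= cosh x.
Proof.
rewrite /cosh; have := expRxMexpNx_1 x; have := expR_gt0 x; have := expR_gt0 (- x).
move: (expR x) (expR (- x)) => e f f0 e0 ef; rewrite ler_pdivlMr// mul1r.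
by rewrite -(@ler_sqr _ 2) ?nnegrE; have := sqr_ge0 (e - f); nra.
Qed.

Lemma cosh_gt0 x : 0 < cosh x.
Proof. exact: lt_le_trans (cosh_ge1 x). Qed.

Lemma sinh_gt0 x : 0 < x -> 0 < sinh x.
Proof. by move=> x0; rewrite /sinh divr_gt0// subr_gt0 ltr_expR; lra. Qed.

Lemma cosh_lt x y : 0 <= x -> x < y -> cosh x < cosh y.
Proof.
move=> x0 xy; have exy : expR x < expR y by rewrite ltr_expR.
have sxy : 1 < expR (x + y) by rewrite expR_gt1; lra.
have E : (cosh y - cosh x) * 2 = (expR y - expR x) * (1 - expR (- (x + y))).
  rewrite /cosh opprD expRD; have := expRxMexpNx_1 x; have := expRxMexpNx_1 y.
  move: (expR x) (expR (- x)) (expR y) (expR (- y)) => a b c d cd ab.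
  have cbd : c * (b * d) = b by rewrite mulrCA cd mulr1.
  have abd : a * (b * d) = d by rewrite mulrA ab mul1r.
  by rewrite (mulrBr (c - a)) mulr1 (mulrBl (b * d)) cbd abd; lra.
rewrite -subr_gt0 -(@pmulr_lgt0 _ 2)// E mulr_gt0 ?subr_gt0//.
by rewrite expR_lt1; lra.
Qed.

Lemma cosh_ltE x y : 0 <= x -> 0 <= y -> (cosh x < cosh y) = (x < y).
Proof.
move=> x0 y0; apply/idP/idP => [|/cosh_lt]; last exact.
apply: contraTT; rewrite -!leNgt le_eqVlt => /predU1P[->//|/(cosh_lt y0)/ltW//].
Qed.

Lemma cosh_leE x y : 0 <= x -> 0 <= y -> (cosh x <= cosh y) = (x <= y).
Proof. by move=> x0 y0; rewrite !leNgt cosh_ltE. Qed.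

Lemma cosh_inj x y : 0 <= x -> 0 <= y -> cosh x = cosh y -> x = y.
Proof.
move=> x0 y0 xy; apply/eqP.
by rewrite eq_le -(cosh_leE x0 y0) -(cosh_leE y0 x0) xy lexx.
Qed.

Lemma cosh_norm x : cosh `|x| = cosh x.
Proof. by case: (ger0P x) => _; rewrite ?coshN. Qed.

Lemma arcosh_ge0 a : 1 <= a -> 0 <= arcosh a.
Proof.
by move=> a1; apply: ln_ge0; apply: le_trans a1 _; rewrite lerDl sqrtr_ge0.
Qed.

Lemma arcoshK a : 1 <= a -> cosh (arcosh a) = a.
Proof.
move=> a1; rewrite /cosh /arcosh; set s := Num.sqrt _.
have s0 : 0 <= s by exact: sqrtr_ge0.
have s2 : s ^+ 2 = a ^+ 2 - 1 by rewrite sqr_sqrtr//; nra.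
rewrite expRN lnK ?posrE; last by lra.
have -> : (a + s)^-1 = a - s.
  by apply: (@mulfI _ (a + s)); [lra|rewrite mulfV; [nra|lra]].
by lra.
Qed.

Lemma coshD_le t x : 0 <= x -> 0 <= t -> cosh (x + t) <= expR t * cosh x.
Proof.
move=> x0 t0; rewrite /cosh mulrA ler_pM2r ?invr_gt0// opprD !expRD mulrDr.
rewrite (mulrC (expR x)) lerD2l (mulrC (expR t)) ler_pM2l ?expR_gt0//.
by rewrite ler_expR; lra.
Qed.

(** Stated with the values at [x / 2] because it is applied to midpoints. *)
Lemma cosh_half_small (e : R) : 0 < e ->
  exists2 d, 0 < d & forall x, 0 <= x -> 2 * cosh (x / 2) - 1 <= expR d -> x < e.
Proof.
move=> e0; pose c := 2 * cosh (e / 2) - 1.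
have c1 : 1 < c by have := @cosh_lt 0 (e / 2) (lexx _); rewrite cosh0 /c; lra.
exists (ln c / 2); first by rewrite divr_gt0// ln_gt0.
move=> x x0 h; have : cosh (x / 2) < cosh (e / 2).
  have : expR (ln c / 2) < c.
    rewrite -[ltRHS](@lnK _ c) ?posrE ?(lt_trans ltr01)// ltr_expR.
    by have := ln_gt0 c1; lra.
  by rewrite {2}/c; lra.
by rewrite cosh_ltE; lra.
Qed.

End hyperbolic_trigonometry.

(** * Geodesics in the hyperboloid model *)

Section geodesics.
Context {R : realType} {n : nat}.
Notation H := (hyperbolic R n).
Implicit Types (p q x : H) (s t l : R).

Lemma minkowskiDl (u v w : 'rV[R]_n.+1) :
  minkowski (u + v) w = minkowski u w + minkowski v w.
Proof. by have := minkowskiDZ 1 u v w; rewrite scale1r mul1r. Qed.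

Lemma minkowskiZl (a : R) (u v : 'rV[R]_n.+1) :
  minkowski (a *: u) v = a * minkowski u v.
Proof.
have m0 : minkowski 0 v = 0.
  by have := minkowskiDZ (-1) v v v; rewrite scaleN1r subrr => ->; lra.
by rewrite -[a *: u]add0r minkowskiDZ m0 add0r.
Qed.

Lemma minkowskiDr (u v w : 'rV[R]_n.+1) :
  minkowski u (v + w) = minkowski u v + minkowski u w.
Proof. by rewrite minkowskiC minkowskiDl !(minkowskiC u). Qed.

Lemma minkowskiZr (a : R) (u v : 'rV[R]_n.+1) :
  minkowski u (a *: v) = a * minkowski u v.
Proof. by rewrite minkowskiC minkowskiZl minkowskiC. Qed.

Lemma cosh_mdist p q : cosh (mdist p q) = - minkowski p q.
Proof. exact: (arcoshK (minkowski_hyperboloid (hyperbolicP p) (hyperbolicP q))). Qed.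

(** The geodesic is the normalised combination of [p] and [q] with weights
    [sinh (l - s)] and [sinh s]. Being linear in [p] and [q], it makes the
    Lorentzian product with any third point computable, which yields the last
    clause. *)
Lemma geodesic_between p q : p != q -> let l := mdist p q in
  exists gamma : R -> H, [/\ geodesic_segment l gamma, gamma 0 = p, gamma l = q &
    forall s x, s \in `[0, l] -> sinh l * cosh (mdist x (gamma s)) =
      sinh (l - s) * cosh (mdist x p) + sinh s * cosh (mdist x q)].
Proof.
move=> pq l; have l0 : 0 < l by rewrite mdist_gt0.
have Sl0 : 0 < sinh l by exact: sinh_gt0.
have Sl1 : sinh l != 0 by rewrite gt_eqF.
pose v s : 'rV[R]_n.+1 := (sinh l)^-1 *:
  (sinh (l - s) *: (p : 'rV_n.+1) + sinh s *: (q : 'rV_n.+1)).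
have pp : minkowski p p = -1 by apply/eqP; case/andP: (hyperbolicP p).
have qq : minkowski q q = -1 by apply/eqP; case/andP: (hyperbolicP q).
have pqE : minkowski p q = - cosh l by rewrite cosh_mdist opprK.
have vv s t : minkowski (v s) (v t) = - cosh (s - t).
  rewrite minkowskiZl minkowskiZr !minkowskiDl !minkowskiDr !minkowskiZl !minkowskiZr.
  rewrite pp qq (minkowskiC q p) pqE coshB !sinhB.
  have := cosh2_sinh2 l; move: (cosh l) (sinh l) Sl1 => C S S0 CS.
  have {}CS : C ^+ 2 = 1 + S ^+ 2 by rewrite -CS subrK.
  transitivity (- (S^-1 ^+ 2 * (S ^+ 2 * cosh s * cosh t + sinh s * sinh t
      - C ^+ 2 * (sinh s * sinh t)))).
    by ring.
  by rewrite CS; field.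
have hv s : s \in `[0, l] -> on_hyperboloid (v s).
  rewrite in_itv/= => /andP[s0 sl]; apply/andP; split.
    by rewrite vv subrr cosh0.
  have p0 := (andP (hyperbolicP p)).2; have q0 := (andP (hyperbolicP q)).2.
  rewrite !mxE mulr_gt0 ?invr_gt0//.
  have sinh_ge0 (t : R) : 0 <= t -> 0 <= sinh t.
    by rewrite le_eqVlt => /predU1P[<-|/sinh_gt0/ltW//]; rewrite sinh0.
  have [->|s1] := eqVneq s 0.
    by rewrite subr0 sinh0 mul0r addr0 mulr_gt0.
  apply: ltr_wpDl; first by rewrite mulr_ge0 ?sinh_ge0 ?subr_ge0 ?(ltW p0).
  by rewrite mulr_gt0// sinh_gt0// lt_neqAle eq_sym s1.
pose gamma s : H := insubd p (v s).
have gammaE s : s \in `[0, l] -> gamma s = v s :> 'rV_n.+1.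
  by move=> sl; rewrite /gamma insubdK//; exact: hv.
have in0 : 0 \in `[0, l] by rewrite in_itv/= lexx ltW.
have inl : l \in `[0, l] by rewrite in_itv/= lexx ltW.
exists gamma; split.
- move=> s t hs ht; apply: cosh_inj; rewrite ?mdist_ge0//.
  by rewrite cosh_mdist !gammaE// vv opprK cosh_norm.
- apply/val_inj; rewrite [LHS]gammaE// /v subr0 sinh0 scale0r addr0.
  by rewrite scalerA mulVf// scale1r.
- apply/val_inj; rewrite [LHS]gammaE// /v subrr sinh0 scale0r add0r.
  by rewrite scalerA mulVf// scale1r.
move=> s x hs; rewrite !cosh_mdist gammaE// minkowskiZr minkowskiDr !minkowskiZr.
by field.
Qed.

(** The identity of [geodesic_between] at the middle of the segment, after
    writing [sinh l] as [2 * sinh (l / 2) * cosh (l / 2)] and cancelling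
    [sinh (l / 2)]. *)
Lemma midpoint p q : exists m : H,
  (forall K : set H, geodesically_convex K -> K p -> K q -> K m) /\
  forall x, 2 * cosh (mdist p q / 2) * cosh (mdist x m) =
    cosh (mdist x p) + cosh (mdist x q).
Proof.
have [->|pq] := eqVneq p q.
  by exists q; split => // x; rewrite mdistxx mul0r cosh0; lra.
have [gamma [gs g0 gl gx]] := geodesic_between pq.
have l0 : 0 < mdist p q by rewrite mdist_gt0.
have hl : mdist p q / 2 \in `[0, mdist p q] by rewrite in_itv/=; lra.
exists (gamma (mdist p q / 2)); split => [K Kc Kp Kq|x].
  by apply: (Kc (mdist p q) gamma); rewrite ?g0 ?gl ?ltW.
have := gx _ x hl; have -> : mdist p q - mdist p q / 2 = mdist p q / 2 by lra.
have -> : sinh (mdist p q) = 2 * sinh (mdist p q / 2) * cosh (mdist p q / 2).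
  have := sinhB (mdist p q / 2) (- (mdist p q / 2)).
  by rewrite opprK -splitr coshN sinhN => ->; ring.
have S0 : 0 < sinh (mdist p q / 2) by apply: sinh_gt0; lra.
by rewrite -mulrDr => E; apply: (mulfI (lt0r_neq0 S0)); rewrite -E; ring.
Qed.

End geodesics.

(** * Distance to a set and nearest points *)

Section distance_to_a_set.
Context {R : realType} {T : metricType R}.
Implicit Types (K L : set T) (x y p : T).

Lemma lipschitz1_continuous (f : T -> R) :
  (forall x y, f x <= mdist x y + f y) -> continuous f.
Proof.
move=> fL x; apply/cvgrPdist_lt => e e0; near=> y.
have xy : mdist x y < e.
  have : ball x e y by near: y; exact: nbhsx_ballx.
  by rewrite ballEmdist.
have := fL x y; have := fL y x; rewrite metric_sym => h1 h2.
by rewrite ltr_norml; apply/andP; split; lra.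
Unshelve. all: by end_near. Qed.

Lemma dist_set_le K x p : K p -> dist_set x K <= mdist x p.
Proof.
move=> Kp; apply: ge_inf; last by exists p.
by exists 0 => _ [q _ <-]; exact: mdist_ge0.
Qed.

Lemma dist_set_ge0 K x : 0 <= dist_set x K.
Proof.
have [->|/set0P[p Kp]] := eqVneq K set0.
  by rewrite /dist_set image_set0 inf0.
by apply: lb_le_inf; [exists (mdist x p), p|move=> _ [q _ <-]; exact: mdist_ge0].
Qed.

Lemma le_dist_set K x (r : R) : K !=set0 ->
  (forall p, K p -> r <= mdist x p) -> r <= dist_set x K.
Proof.
move=> [p Kp] h; apply: lb_le_inf; first by exists (mdist x p), p.
by move=> _ [q Kq <-]; exact: h.
Qed.

Lemma dist_set_triangle K x y : K !=set0 ->
  dist_set x K <= mdist x y + dist_set y K.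
Proof.
move=> K0; rewrite -lerBlDl; apply: le_dist_set => // p Kp.
rewrite lerBlDl; exact: le_trans (dist_set_le _ Kp) (metric_triangle _ _ _).
Qed.

Lemma dist_set_continuous K : K !=set0 -> continuous (fun x => dist_set x K).
Proof.
by move=> K0; apply: lipschitz1_continuous => x y; exact: dist_set_triangle.
Qed.

Lemma dist_set_attained K x : compact K -> K !=set0 ->
  exists2 p, K p & mdist x p = dist_set x K.
Proof.
move=> cK K0; have cx : continuous (mdist x).
  apply: lipschitz1_continuous => y z; rewrite addrC (metric_sym y).
  exact: metric_triangle.
have [|p /set_mem Kp pmin] := compact_EVT_min K0 cK (f := mdist x).
  exact: continuous_subspaceT.
exists p => //; apply/eqP; rewrite eq_le dist_set_le// andbT.
by apply: le_dist_set => // q Kq; apply: pmin; rewrite inE.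
Qed.

Lemma dist_set_attained_lt K x (r : R) : K !=set0 -> dist_set x K < r ->
  exists2 p, K p & mdist x p < r.
Proof.
by move=> [p Kp] /inf_lt[|_ [q Kq <-]]; [exists (mdist x p), p|exists q].
Qed.

Lemma dist_set_perturb K L x (r : R) : K !=set0 -> L !=set0 ->
  L `<=` open_nbhd r K -> dist_set x K <= dist_set x L + r.
Proof.
move=> K0 L0 LK; rewrite -lerBlDr; apply: le_dist_set => // p Lp.
rewrite lerBlDr; apply: le_trans (dist_set_triangle x p K0) _.
by rewrite lerD2l ltW//; exact: LK.
Qed.

Lemma open_nbhd_bounded K L : compact K -> K !=set0 -> L !=set0 ->
  exists2 r, 0 < r & K `<=` open_nbhd r L.
Proof.
move=> cK K0 L0; have [|p _ pmax] := compact_EVT_max K0 cK (f := fun x => dist_set x L).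
  exact/continuous_subspaceT/dist_set_continuous.
exists (dist_set p L + 1); first by rewrite ltr_wpDl ?dist_set_ge0.
move=> x Kx; have /pmax : x \in K by rewrite inE.
by rewrite /open_nbhd/= => /le_lt_trans; apply; rewrite ltrDl.
Qed.

(** Compactness ensures that the infimum defining the Hausdorff distance is not
    over the empty set, on which it would be [0]. *)
Lemma hausdorff_dist_lt K L (r : R) : compact K -> K !=set0 -> compact L ->
  L !=set0 -> hausdorff_dist K L < r -> K `<=` open_nbhd r L /\ L `<=` open_nbhd r K.
Proof.
move=> cK K0 cL L0; rewrite /hausdorff_dist; set S := [set _ | _] => h.
have [a a0 Ka] := open_nbhd_bounded cK K0 L0.
have [b b0 Lb] := open_nbhd_bounded cL L0 K0.
have mono M s t : s <= t -> open_nbhd s M `<=` open_nbhd t M.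
  by move=> st x /lt_le_trans; apply.
have [|s [s0 Ks Ls] sr] := inf_lt (S := S) _ h.
  exists (Num.max a b); split; first by rewrite lt_max a0.
  - by apply: subset_trans Ka _; apply: mono; rewrite le_max lexx.
  - by apply: subset_trans Lb _; apply: mono; rewrite le_max lexx orbT.
by split; [apply: subset_trans Ks _|apply: subset_trans Ls _]; exact/mono/ltW.
Qed.

End distance_to_a_set.

Section nearest_point.
Context {R : realType} {n : nat}.
Notation H := (hyperbolic R n).
Implicit Types (K L : set H) (x y p q : H).

Lemma convex_body_neq0 K : convex_body K -> K !=set0.
Proof. by move=> [_ _ [x /interior_subset Kx]]; exists x. Qed.

(** If the nearest point [p] were interior, a point of the segment from [p] to
    [x] close to [p] would still lie in [K] and be closer to [x]. *)
Lemma nearest_boundary K x p : closed K -> ~ K x -> K p ->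
  mdist x p = dist_set x K -> boundary K p.
Proof.
move=> cK Kx Kp xp; split; first exact: subset_closure.
rewrite /interior => /nbhs_ballP[e /= e0 eK].
have px : p != x by apply/eqP => px; apply: Kx; rewrite -px.
have l0 : 0 < mdist p x by rewrite mdist_gt0.
have [gamma [gs g0 gl _]] := geodesic_between px.
pose s := Num.min (e / 2) (mdist p x).
have s0 : 0 < s by rewrite lt_min l0 divr_gt0.
have sl : s <= mdist p x by rewrite ge_min lexx orbT.
have se : s <= e / 2 by rewrite ge_min lexx.
have in0 : 0 \in `[0, mdist p x] by rewrite in_itv/= lexx ltW.
have inl : mdist p x \in `[0, mdist p x] by rewrite in_itv/= lexx ltW.
have ins : s \in `[0, mdist p x] by rewrite in_itv/= sl ltW.
have /eK Ks : ball p e (gamma s).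
  rewrite ballEmdist/= -g0 gs// sub0r normrN gtr0_norm//; lra.
have gsx : mdist (gamma s) x = mdist p x - s.
  by rewrite -[in LHS]gl gs// distrC ger0_norm// subr_ge0.
by have := dist_set_le x Ks; rewrite -xp (metric_sym x (gamma s)) gsx (metric_sym x p); lra.
Qed.

(** Inside [K] the projection is the identity: at a boundary point the only
    candidate is the point itself, and at an interior point there is no
    candidate, so that [xget] returns its default value. Hence the projection is
    a total map with the same metric characterisation everywhere. *)
Lemma nearest_pointP K x : convex_body K ->
  [/\ K (nearest_point K x), mdist x (nearest_point K x) = dist_set x K &
      ~ K x -> boundary K (nearest_point K x)].
Proof.
move=> Kb; have K0 := convex_body_neq0 Kb; have [cK _ _] := Kb.
have clK : closed K by apply: compact_closed => //; exact: metric_hausdorff.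
have dist0 : K x -> dist_set x K = 0.
  move=> Kx; apply/eqP; rewrite eq_le dist_set_ge0 andbT.
  by rewrite -(mdistxx x) dist_set_le.
rewrite /nearest_point; set S := [set _ | _].
have [Sp|/forallNP Pn] := pselect (exists p, S p).
  have [bp pd] := xgetPex x Sp; split => //.
  - by rewrite [K](closure_id K).1//; case: bp.
  - by rewrite metric_sym.
rewrite xgetPN//; have Kx : K x.
  apply: contrapT => Kx; have [p Kp px] := dist_set_attained x cK K0.
  by apply: (Pn p); split; [exact: nearest_boundary px|rewrite metric_sym].
by split => //; rewrite mdistxx dist0.
Qed.

(** The midpoint [m] of [p] and [q] lies in [K], so it is no closer to [x] than
    [p]; the midpoint formula turns this into a bound on the distance from [p]
    to [q]. *)
Lemma nearest_point_stable K x q (t : R) : convex_body K -> K q -> 0 <= t ->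
  mdist x q <= dist_set x K + t ->
  2 * cosh (mdist (nearest_point K x) q / 2) - 1 <= expR t.
Proof.
move=> Kb Kq t0 xq; have [Kp xp _] := nearest_pointP x Kb.
move: (nearest_point K x) Kp xp => p Kp xp.
have [m [Km mE]] := midpoint p q; have [_ Kc _] := Kb.
have /(dist_set_le x) := Km K Kc Kp Kq; rewrite -xp in xq *.
rewrite -cosh_leE ?mdist_ge0// => pm.
have : cosh (mdist x q) <= expR t * cosh (mdist x p).
  apply: le_trans (coshD_le (mdist_ge0 _ _) t0).
  by rewrite cosh_leE ?mdist_ge0// addr_ge0 ?mdist_ge0.
have := mE x; have := cosh_ge1 (mdist p q / 2); have := cosh_gt0 (mdist x p).
move: pm; move: (cosh (mdist x p)) (cosh (mdist x m)) (cosh (mdist x q)).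
move: (cosh (mdist p q / 2)) (expR t) => C E X M Q XM X0 C1 CE QX.
rewrite -(ler_pM2r X0) mulrBl mul1r lerBlDr.
apply: le_trans (_ : X + Q <= _); last by rewrite addrC lerD2r.
by rewrite -CE ler_pM2l// mulr_gt0//; lra.
Qed.

Lemma nearest_point_continuous K : convex_body K -> continuous (nearest_point K).
Proof.
move=> Kb x; apply/(@metricType_numDomainType.cvgrPdist_lt _ _ _ (nbhs x)) => e e0.
have [d d0 dP] := cosh_half_small e0.
near=> y; have xy : mdist x y < d / 2.
  have : ball x (d / 2) y by near: y; apply: nbhsx_ballx; rewrite divr_gt0.
  by rewrite ballEmdist.
apply: dP; first exact: mdist_ge0.
have [Ky yE _] := nearest_pointP y Kb.
apply: nearest_point_stable => //; first exact: ltW.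
have := dist_set_triangle y x (convex_body_neq0 Kb); rewrite -yE.
have := metric_triangle x y (nearest_point K y); rewrite (metric_sym y x); lra.
Unshelve. all: by end_near. Qed.

Lemma nearest_point_cvg (K_ : nat -> set H) K x : convex_body K ->
  (forall j, convex_body (K_ j)) ->
  (forall r : R, 0 < r -> \forall j \near \oo,
    K_ j `<=` open_nbhd r K /\ K `<=` open_nbhd r (K_ j)) ->
  nearest_point (K_ j) x @[j --> \oo] --> nearest_point K x.
Proof.
move=> Kb Kjb KjK; apply/metricType_numDomainType.cvgrPdist_lt => e e0.
have e20 : 0 < e / 2 by rewrite divr_gt0.
have [d d0 dP] := cosh_half_small e20.
have r0 : 0 < Num.min (d / 2) (e / 2) by rewrite lt_min e20 divr_gt0.
near=> j; have [KjKr KKjr] : K_ j `<=` open_nbhd (Num.min (d / 2) (e / 2)) K /\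
    K `<=` open_nbhd (Num.min (d / 2) (e / 2)) (K_ j).
  by near: j; exact: KjK.
have [Kq qE _] := nearest_pointP x (Kjb j).
have [K0 Kj0] := (convex_body_neq0 Kb, convex_body_neq0 (Kjb j)).
have [p Kp] := dist_set_attained_lt K0 (KjKr _ Kq).
rewrite lt_min => /andP[qpd qpe].
have : mdist (nearest_point K x) p < e / 2.
  apply: dP; first exact: mdist_ge0.
  apply: nearest_point_stable => //; first exact: ltW.
  have := dist_set_perturb x Kj0 K0 KKjr; rewrite -qE.
  have := metric_triangle x (nearest_point (K_ j) x) p.
  have : Num.min (d / 2) (e / 2) <= d / 2 by rewrite ge_min lexx.
  by lra.
have := metric_triangle (nearest_point K x) p (nearest_point (K_ j) x).
by rewrite (metric_sym p); lra.
Unshelve. all: by end_near. Qed.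

Lemma dist_set_cvg (K_ : nat -> set H) K x : K !=set0 ->
  (forall j, K_ j !=set0) ->
  (forall r : R, 0 < r -> \forall j \near \oo,
    K_ j `<=` open_nbhd r K /\ K `<=` open_nbhd r (K_ j)) ->
  dist_set x (K_ j) @[j --> \oo] --> dist_set x K.
Proof.
move=> K0 Kj0 KjK; apply/cvgrPdist_le => e e0; near=> j.
have [KjKr KKjr] : K_ j `<=` open_nbhd e K /\ K `<=` open_nbhd e (K_ j).
  by near: j; exact: KjK.
have := dist_set_perturb x (Kj0 j) K0 KKjr; have := dist_set_perturb x K0 (Kj0 j) KjKr.
by rewrite ler_norml => h1 h2; apply/andP; split; lra.
Unshelve. all: by end_near. Qed.

End nearest_point.

(** * The hyperbolic volume is a Borel measure *)

Section hyperbolic_volume_measure.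
Context {R : realType} {n : nat}.
Notation H := (hyperbolic R n).
Notation Tn := (n.-tuple (measurableTypeR R)).
Implicit Types (u v : n.-tuple R).

Lemma measurable_coordinate (i : 'I_n) :
  measurable_fun [set: Tn] (fun u : Tn => tnth u i : R).
Proof. exact: measurable_tnth. Qed.

Lemma measurable_sqrt : measurable_fun [set: R] (@Num.sqrt R).
Proof. exact: (continuous_measurable_fun (@sqrt_continuous R)). Qed.

Lemma measurable_hyp_height : measurable_fun [set: Tn] (hyp_height : Tn -> R).
Proof.
apply: (measurableT_comp measurable_sqrt).
apply: measurable_funD; first exact: measurable_cst.
apply: measurable_sum => i; apply: measurable_funX; exact: measurable_coordinate.
Qed.

Lemma hyp_height_gt0 u : 0 < hyp_height u.
Proof. by have /andP[_] := hyp_graphP u; rewrite mxE unlift_none. Qed.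

Lemma minkowski_hyp_chart u v : minkowski (hyp_chart u) (hyp_chart v) =
  \sum_(i < n) tnth u i * tnth v i - hyp_height u * hyp_height v.
Proof.
rewrite /Defs.minkowski !mxE unlift_none; congr (_ - _).
by apply: eq_bigr => i _; rewrite !mxE liftK.
Qed.

(** Spatial coordinates control the distance because the time coordinate
    contributes negatively to the Lorentzian square of a difference. *)
Lemma cosh_mdist_hyp_chart u v : cosh (mdist (hyp_chart u) (hyp_chart v)) <=
  1 + (\sum_(i < n) (tnth u i - tnth v i) ^+ 2) / 2.
Proof.
rewrite cosh_mdist minkowski_hyp_chart.
have h (w : n.-tuple R) : hyp_height w ^+ 2 = 1 + \sum_(i < n) tnth w i ^+ 2.
  by rewrite sqr_sqrtr// addr_ge0// sumr_ge0// => i _; exact: sqr_ge0.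
have -> : \sum_(i < n) (tnth u i - tnth v i) ^+ 2 =
    \sum_(i < n) tnth u i ^+ 2 + \sum_(i < n) tnth v i ^+ 2
    - 2 * \sum_(i < n) tnth u i * tnth v i.
  rewrite mulr_sumr -sumrN -!big_split; apply: eq_bigr => i _ /=; ring.
have := h u; have := h v; have := sqr_ge0 (hyp_height u - hyp_height v).
by move: (hyp_height u) (hyp_height v) => a b; nra.
Qed.

Lemma rational_chart_dense u (e : R) : 0 < e ->
  exists q : n.-tuple rat,
    mdist (hyp_chart [tuple of map ratr q]) (hyp_chart u) < e.
Proof.
move=> e0; have c0 : 0 < cosh e - 1 by have := cosh_lt (lexx 0) e0; rewrite cosh0; lra.
(* As [d <= 1], each of the [n] squared differences is at most [d ^+ 2 <= c], and
   [n * c <= cosh e - 1]. *)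
pose c := (cosh e - 1) / n.+1%:R; have {}c0' : 0 < c by rewrite divr_gt0.
pose d := Num.min 1 c; have d0 : 0 < d by rewrite lt_min ltr01.
have /choice[q qP] : forall i : 'I_n, exists q : rat,
    ratr q \in `](tnth u i - d), (tnth u i + d)[.
  by move=> i; apply: rat_in_itvoo; lra.
exists [tuple q i | i < n]; rewrite -cosh_ltE ?mdist_ge0 ?ltW//.
apply: le_lt_trans (cosh_mdist_hyp_chart _ _) _.
suff : \sum_(i < n) (tnth [tuple of map ratr [tuple q i | i < n]] i - tnth u i) ^+ 2
    <= cosh e - 1 by lra.
apply: le_trans (_ : \sum_(i < n) c <= _).
  apply: ler_sum => i _; rewrite tnth_map tnth_mktuple.
  have := qP i; rewrite in_itv/= => /andP[q1 q2].
  have d1 : d <= 1 by rewrite ge_min lexx.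
  have dc : d <= c by rewrite ge_min lexx orbT.
  move: (ratr (q i)) q1 q2 => r q1 q2; nra.
rewrite sumr_const card_ord -[leRHS](@divfK _ n.+1%:R)// -/c -(mulr_natr c).
by rewrite ler_pM2l// ler_nat.
Qed.

Lemma measurable_hyp_chart_ball u (r : R) : 0 < r ->
  measurable [set v : Tn | mdist (hyp_chart u) (hyp_chart v) < r].
Proof.
move=> r0; pose f (v : Tn) : R :=
  hyp_height u * hyp_height v - \sum_(i < n) tnth u i * tnth v i.
have mf : measurable_fun setT f.
  apply: measurable_funB.
    by apply: measurable_funM => //; exact: measurable_hyp_height.
  apply: measurable_sum => i; apply: measurable_funM => //.
  exact: measurable_coordinate.
rewrite (_ : [set _ | _] = setT `&` f @^-1` `]-oo, cosh r[%classic).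
  by apply: mf => //; exact: measurable_itv.
have fE v : f v = cosh (mdist (hyp_chart u) (hyp_chart v)).
  by rewrite cosh_mdist minkowski_hyp_chart opprB.
rewrite setTI; apply/seteqP; split => v /=;
  by rewrite in_itv/= fE cosh_ltE ?mdist_ge0 ?ltW.
Qed.

(** An open set is the union of the balls that it contains among the countably
    many with rational centre and radius [1 / k]; preimages of balls are
    sublevel sets of an explicit measurable function. *)
Lemma measurable_hyp_chart : measurable_fun [set: Tn] (hyp_chart : Tn -> H).
Proof.
apply: (measurability (@open H)) => // _ [U oU <-]; rewrite setTI.
pose q_chart (q : n.-tuple rat) : n.-tuple R := [tuple of map ratr q].
pose F (qk : n.-tuple rat * nat) : set Tn :=
  [set v | mdist (hyp_chart (q_chart qk.1)) (hyp_chart v) < qk.2.+1%:R^-1 /\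
    ball (hyp_chart (q_chart qk.1)) qk.2.+1%:R^-1 `<=` U].
rewrite (_ : _ @^-1` U = \bigcup_qk F qk).
  apply: countable_bigcupT_measurable => [|[q k]]; first exact: countableP.
  rewrite /F/=; have [qU|qU] := pselect (ball (hyp_chart (q_chart q)) k.+1%:R^-1 `<=` U).
    rewrite (_ : [set _ | _] =
        [set v | mdist (hyp_chart (q_chart q)) (hyp_chart v) < k.+1%:R^-1]).
      by apply: measurable_hyp_chart_ball; rewrite invr_gt0.
    by apply/seteqP; split => v /= => [[]|].
  rewrite (_ : [set _ | _] = set0)//.
  by apply/seteqP; split => v //= [].
apply/seteqP; split => v /=; last first.
  by move=> [[q k] _ [/= vq]]; apply; rewrite ballEmdist.
move=> Uv; have /nbhs_ballP[e /= e0 eU] : nbhs (hyp_chart v) U by exact: open_nbhs_nbhs.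
have [k ke] : exists k, k.+1%:R^-1 < e / 2.
  have e20 : 0 < e / 2 by rewrite divr_gt0.
  by exists (Num.truncn (e / 2)^-1); rewrite invf_plt ?posrE// truncnS_gt.
have [|q qv] := @rational_chart_dense v k.+1%:R^-1; first by rewrite invr_gt0.
exists (q, k) => //; split => //= y; rewrite ballEmdist/= => qy.
apply: eU; rewrite ballEmdist/=.
have := metric_triangle (hyp_chart v) (hyp_chart (q_chart q)) y.
rewrite -/(q_chart q) in qv; rewrite (metric_sym _ (hyp_chart (q_chart q))).
move=> vqy; apply: (le_lt_trans vqy); rewrite (splitr e).
by apply: ltrD; [exact: lt_trans qv ke|exact: lt_trans qy ke].
Qed.

Definition hyp_density (u : Tn) : R := Num.sqrt (\det (hyp_metric u)).

Lemma measurable_hyp_density : measurable_fun [set: Tn] hyp_density.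
Proof.
apply: (measurableT_comp measurable_sqrt).
apply: measurable_sum => s; apply: measurable_funM => //.
have mt i k : measurable_fun [set: Tn] (fun u : Tn => hyp_tangent u i 0 k : R).
  (* The inverse of a positive number is written as a power because powers are
     measurable in their base. *)
  rewrite (_ : (fun _ => _) = (fun u : Tn => if unlift ord0 k is Some j
      then (j == i)%:R else tnth u i * powR (hyp_height u) (-1)) :> (Tn -> R)); last first.
    apply/funext => u; rewrite mxE; case: (unlift _ _) => //.
    by rewrite powR_inv1// ltW// hyp_height_gt0.
  case: (unlift _ _) => [j|]; first exact: measurable_cst.
  apply: measurable_funM; first exact: measurable_coordinate.
  apply: (@measurableT_comp _ _ _ _ _ _ (fun x : R => powR x (-1)));
    [exact: measurable_powR|exact: measurable_hyp_height].
apply: measurable_prod => i _.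
under eq_fun do rewrite mxE /Defs.minkowski.
apply: measurable_funB; last by apply: measurable_funM; exact: mt.
by apply: measurable_sum => j; apply: measurable_funM; exact: mt.
Qed.

Let hyp_vol0 : @hyp_vol R n set0 = 0%E.
Proof. by rewrite /hyp_vol preimage_set0 integral_set0. Qed.

Let hyp_vol_ge0 (A : set H) : (0 <= hyp_vol A)%E.
Proof. by apply: integral_ge0 => u _; rewrite lee_fin sqrtr_ge0. Qed.

Let hyp_vol_sigma_additive : semi_sigma_additive (@hyp_vol R n).
Proof.
move=> F mF tF mUF; have mcF i : measurable (hyp_chart @^-1` F i : set Tn).
  by rewrite -[X in measurable X]setTI; exact: measurable_hyp_chart.
have d0 (u : Tn) : (0 <= (hyp_density u)%:E)%E by rewrite lee_fin sqrtr_ge0.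
have -> : hyp_vol (\bigcup_i F i) = (\sum_(i <oo) hyp_vol (F i))%E.
  rewrite /hyp_vol preimage_bigcup ge0_integral_bigcup//.
  - exact: (measurable_funTS ((measurable_EFinP _ _).2 measurable_hyp_density)).
  - by move=> i j _ _ [u [Fi Fj]]; apply: tF => //; exists (hyp_chart u).
by apply: is_cvg_ereal_nneg_natsum => i _; exact: hyp_vol_ge0.
Qed.

HB.instance Definition _ := isMeasure.Build _ _ _ (@hyp_vol R n)
  hyp_vol0 hyp_vol_ge0 hyp_vol_sigma_additive.

End hyperbolic_volume_measure.

(** * Linear independence of the Steiner coefficients *)

Section linear_span.

(** Take a matrix of maximal rank with rows in [W]. If its row space missed some
    vector, a column of its cokernel would be a nonzero functional killing the
    row space; by hypothesis some element of [W] is not killed, and adding it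
    increases the rank. *)
Lemma separated_subspace_full (F : fieldType) (n : nat) (W : 'rV[F]_n -> Prop) :
  W 0 -> (forall a u v, W u -> W v -> W (a *: u + v)) ->
  (forall c : 'cV[F]_n, (forall w, W w -> w *m c = 0) -> c = 0) ->
  forall w, W w.
Proof.
move=> W0 Wlin Wsep.
have Wmul m (A : 'M[F]_(m, n)) (u : 'rV_m) : (forall i, W (row i A)) -> W (u *m A).
  move=> WA; rewrite mulmx_sum_row; apply: (big_ind W) => // [v w Wv Ww|i _].
    by rewrite -[v]scale1r; exact: Wlin.
  by rewrite -[_ *: _]addr0; exact: Wlin.
pose P k := `[< exists2 A : 'M[F]_n, \rank A = k & forall i, W (row i A) >].
have P0 : exists k, P k.
  by exists 0%N; apply/asboolP; exists 0 => [|i]; rewrite ?mxrank0// linear0.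
have Pn k : P k -> (k <= n)%N by move=> /asboolP[A <- _]; exact: rank_leq_row.
case: (ex_maxnP P0 Pn) => k /asboolP[A Ak WA] kmax w.
have [/submxP[u ->]|wA] := boolP (w <= A)%MS; first exact: Wmul.
have [j cj0] : exists j, col j (cokermx A) != 0.
  apply/existsP; apply: contraR wA; rewrite negb_exists => /forallP h.
  rewrite submxE; apply/eqP; rewrite (_ : cokermx A = 0) ?mulmx0//.
  by apply/matrixP => i j; have := h j; rewrite negbK => /eqP/colP/(_ i); rewrite !mxE.
have [v Wv vj] : exists2 v, W v & v *m col j (cokermx A) != 0.
  apply: contrapT => /forall2NP h; move/eqP: cj0; apply; apply: Wsep => v Wv.
  by case: (h v) => // /negP; rewrite negbK => /eqP.
have vA : ~~ (v <= A)%MS.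
  apply: contra vj; rewrite submxE => /eqP vA.
  by rewrite colE mulmxA vA mul0mx.
suff /kmax : P (\rank (A + v)%MS).
  have := mxrankS (addsmxSl A v); rewrite Ak => le1 le2.
  have /eqP rE : \rank A == \rank (A + v)%MS by rewrite Ak eqn_leq le1 le2.
  case/negP: vA; apply: submx_trans (addsmxSr A v) _.
  by have := mxrank_leqif_sup (addsmxSl A v); case=> _ <-; rewrite rE.
apply/asboolP; exists (A + v)%MS => // i.
have /sub_addsmxP[u ->] := row_sub i (A + v)%MS.
rewrite -[_ *m A]scale1r; apply: Wlin; first exact: Wmul.
by apply: Wmul => k'; rewrite (_ : row k' v = v)// [k']ord1; apply/rowP => l; rewrite mxE.
Qed.

End linear_span.

Section steiner_coefficients.
Context {R : realType}.
Notation mu := (@lebesgue_measure R).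

Definition steiner_density (n r : nat) (x : R) : R :=
  sinh x ^+ (n.-1 - r) * cosh x ^+ r.

Lemma continuous_steiner_density n r : continuous (steiner_density n r).
Proof.
have cexpN : continuous (fun x : R => expR (- x)).
  by move=> x; apply: continuous_comp; [exact: opp_continuous|exact: continuous_expR].
move=> x; apply: cvgM.
  apply: (@continuous_comp _ _ _ (@sinh R) (fun y => y ^+ _)).
    apply: cvgM; last exact: cvg_cst.
    by apply: cvgB; [exact: continuous_expR|exact: cexpN].
  exact: exprn_continuous.
apply: (@continuous_comp _ _ _ (@cosh R) (fun y => y ^+ _)).
  apply: cvgM; last exact: cvg_cst.
  by apply: cvgD; [exact: continuous_expR|exact: cexpN].
exact: exprn_continuous.
Qed.

Lemma is_derive_steiner_coef n r (t : R) : 0 < t ->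
  is_derive t 1 (steiner_coef n r) (steiner_density n r t).
Proof.
move=> t0; have tt1 : t < t + 1 by rewrite ltrDl.
have int_f : mu.-integrable `[0, t + 1] (EFin \o steiner_density n r).
  apply: continuous_compact_integrable; first exact: segment_compact.
  exact/continuous_subspaceT/continuous_steiner_density.
have [dF F'] := continuous_FTC1_closed tt1 int_f t0 (@continuous_steiner_density n r t).
by apply: DeriveDef; [exact: dF|rewrite -derive1E].
Qed.

Lemma continuous_steiner_coef n r (t : R) : 0 < t ->
  {for t, continuous (steiner_coef n r)}.
Proof.
move=> /(is_derive_steiner_coef n r)[dl _].
exact/differentiable_continuous/derivable1_diffP.
Qed.

Lemma steiner_coef_ge0 n r (t : R) : 0 <= steiner_coef n r t.
Proof.
apply: Rintegral_ge0 => x /=; rewrite in_itv/= => /andP[x0 _].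
rewrite mulr_ge0 ?exprn_ge0//; last exact/ltW/cosh_gt0.
by move: x0; rewrite le_eqVlt => /predU1P[<-|/sinh_gt0/ltW//]; rewrite sinh0.
Qed.

(** Dividing by a power of [cosh] turns a linear relation between the
    [steiner_density n r] into a polynomial relation satisfied by all values of
    the hyperbolic tangent. *)
Lemma steiner_density_free n (c : 'I_n -> R) :
  (forall t, 0 < t -> \sum_(r < n) c r * steiner_density n r t = 0) ->
  forall r, c r = 0.
Proof.
move=> h; pose p : {poly R} := \sum_(r < n) c r *: 'X^(n.-1 - r).
pose th (t : R) := sinh t / cosh t.
have th_root t : 0 < t -> root p (th t).
  move=> t0; have C0 : cosh t != 0 by rewrite gt_eqF// cosh_gt0.
  have Cn0 : cosh t ^+ n.-1 != 0 by rewrite expf_neq0.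
  apply/eqP/(mulfI Cn0); rewrite mulr0 -(h t t0) horner_sum mulr_sumr.
  apply: eq_bigr => r _; rewrite hornerZ hornerXn mulrCA; congr (_ * _).
  have rn : (r <= n.-1)%N by rewrite -ltnS (leq_trans (ltn_ord r))// leqSpred.
  have -> : cosh t ^+ n.-1 = cosh t ^+ (n.-1 - r) * cosh t ^+ r.
    by rewrite -exprD subnK.
  have A0 : cosh t ^+ (n.-1 - r) != 0 by rewrite expf_neq0.
  rewrite /th /steiner_density (expr_div_n (sinh t)); move: A0 (sinh t ^+ _).
  by move: (cosh t ^+ (n.-1 - r)) => A A0 S; field.
have th_inj s t : th s = th t -> s = t.
  (* [sinh (s - t)] is the cross product of the two fractions. *)
  have C0 x : cosh x != 0 :> R by rewrite gt_eqF ?cosh_gt0.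
  rewrite /th => /eqP; rewrite eqr_div// => /eqP st; have : sinh (s - t) = 0.
    by rewrite sinhB st mulrC subrr.
  have [st0|st0|/eqP]:= ltgtP (s - t) 0; last by rewrite subr_eq0 => /eqP.
    have := @sinh_gt0 _ (- (s - t)); rewrite sinhN; lra.
  have := sinh_gt0 st0; lra.
have p0 : p = 0.
  apply: contrapT => /eqP p0.
  have := max_poly_roots (rs := [seq th k.+1%:R | k <- iota 0 n]) p0.
  rewrite size_map size_iota ltnNge => /(_ _ _)/negP; apply.
  - by apply/allP => _ /mapP[k _ ->]; apply: th_root.
  - rewrite map_inj_uniq ?iota_uniq// => k l /th_inj/eqP.
    by rewrite eqr_nat => /eqP[].
  apply: leq_trans (size_sum _ _ _) _; apply/bigmax_leqP => r _.
  apply: leq_trans (size_scale_leq _ _) _; rewrite size_polyXn.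
  by case: n r {c h p th_root p0} => [[]//|m r]; rewrite ltnS leq_subr.
move=> r; have : p`_(n.-1 - r) = 0 by rewrite p0 coef0.
rewrite coef_sum (bigD1 r)//= coefZ coefXn eqxx mulr1 big1 ?addr0// => s sr.
rewrite coefZ coefXn; case: eqP; rewrite ?mulr0// => rs.
have : r = s by apply/ord_inj; have := ltn_ord r; have := ltn_ord s; lia.
by move=> rsE; rewrite rsE eqxx in sr.
Qed.

(** Differentiating a relation with respect to the outer radius reduces to
    [steiner_density_free]. *)
Lemma steiner_coef_free n (c : 'I_n -> R) :
  (forall s t, 0 < s -> s < t ->
    \sum_(r < n) c r * (steiner_coef n r t - steiner_coef n r s) = 0) ->
  forall r, c r = 0.
Proof.
move=> h; apply: steiner_density_free => t t0.
pose G : R -> R := \sum_(r < n) c r *: steiner_coef n r.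
have dG : is_derive t 1 G (\sum_(r < n) c r *: steiner_density n r t).
  apply: is_derive_sum => r; apply: is_deriveZ; exact: is_derive_steiner_coef.
rewrite -[LHS](@derive_val _ _ _ _ _ _ _ dG) (@near_eq_derive _ _ _ G (cst (G t))).
  by rewrite derive_cst.
have GB x y : G x - G y = \sum_(r < n) c r * (steiner_coef n r x - steiner_coef n r y).
  rewrite /G !fct_sumE -sumrB; apply: eq_bigr => r _.
  by rewrite mulrBr.
near=> x; have x0 : 0 < x by near: x; exact: lt_nbhsr.
apply/eqP; rewrite -subr_eq0; have [xt|tx|->] := ltgtP x t; last by rewrite subrr.
  by rewrite -oppr_eq0 opprB GB h.
by rewrite GB h.
Unshelve. all: by end_near. Qed.

End steiner_coefficients.

(** * Integrals over annuli *)

Section integration_tools.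
Local Open Scope ereal_scope.

Lemma ge0_integral_mrestr d (T : measurableType d) (R : realType)
    (mu : {measure set T -> \bar R}) (D : set T) (mD : measurable D) (f : T -> \bar R) :
  measurable_fun setT f -> (forall x, 0 <= f x) ->
  \int[mrestr mu mD]_x f x = \int[mu]_(x in D) f x.
Proof.
move=> mf f0; have mDC : measurable (~` D) by exact: measurableC.
rewrite -(setUv D) ge0_integral_setU//; last 2 first.
- exact: measurable_funTS.
- by apply/disj_setPS => x [].
rewrite (@eq_measure_integral _ _ _ _ mu _); last first.
  by move=> A mA AD; rewrite /= /mrestr setIidl.
rewrite [X in _ + X](@eq_measure_integral _ _ _ _ mzero _); last first.
  move=> A mA AD; rewrite /= /mrestr (_ : A `&` D = set0) ?measure0//.
  by apply/seteqP; split => // x [/AD].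
by rewrite integral_measure_zero adde0.
Qed.

(** The family is extended by zero from ['I_n] to [nat] in order to be summed
    as a sequence of measures. *)
Lemma ge0_integral_measure_lincomb d (T : measurableType d) (R : realType) (n : nat)
    (nu : {measure set T -> \bar R}) (c : 'I_n -> R)
    (mu : 'I_n -> {measure set T -> \bar R}) (f : T -> \bar R) :
  (forall r, 0 <= c r)%R ->
  (forall A, measurable A -> nu A = \sum_(r < n) (c r)%:E * mu r A) ->
  measurable_fun setT f -> (forall x, 0 <= f x) ->
  \int[nu]_x f x = \sum_(r < n) (c r)%:E * \int[mu r]_x f x.
Proof.
move=> c0 nuE mf f0.
pose m (k : nat) : {measure set T -> \bar R} :=
  if insub k is Some r then [the measure _ _ of mscale (NngNum (c0 r)) (mu r)]
  else [the measure _ _ of mzero].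
rewrite (@eq_measure_integral _ _ _ _ [the measure _ _ of msum m n] _); last first.
  move=> A mA _; rewrite nuE//= /msum; apply: eq_bigr => r _.
  by rewrite /m valK.
rewrite ge0_integral_measure_sum//; apply: eq_bigr => r _.
by rewrite /m valK ge0_integral_mscale.
Qed.

End integration_tools.

Section borel.
Context {R : realType} {n : nat}.
Notation H := (hyperbolic R n).

Lemma open_measurable_hyp (U : set H) : open U -> measurable U.
Proof. exact: sub_sigma_algebra. Qed.

Lemma closed_measurable_hyp (F : set H) : closed F -> measurable F.
Proof.
by rewrite -openC => /open_measurable_hyp/measurableC; rewrite setCK.
Qed.

Lemma continuous_measurable_hyp (f : H -> H) : continuous f -> measurable_fun setT f.
Proof.
move=> cf; apply: (measurability (@open H)) => // _ [U oU <-]; rewrite setTI.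
by apply: open_measurable_hyp; apply: open_comp => // x _; exact: cf.
Qed.

Lemma continuous_measurable_real (f : H -> R) : continuous f -> measurable_fun setT f.
Proof.
move=> cf; apply: (measurability (@RGenOInfty.G R)).
  exact: RGenOInfty.measurableE.
move=> _ [_ [x ->] <-]; rewrite setTI.
by apply: open_measurable_hyp; apply: open_comp => [y _|]; [exact: cf|exact: rray_open].
Qed.

Lemma bounded_integral_fin_num (m : {finite_measure set H -> \bar R})
    (phi : H -> R) (M : R) : continuous phi ->
  (forall x, 0 <= phi x) -> (forall x, phi x <= M) ->
  (\int[m]_x (phi x)%:E \is a fin_num)%E.
Proof.
move=> cphi phi0 phiM; have mphi : measurable_fun setT (EFin \o phi).
  by apply/measurable_EFinP; exact: continuous_measurable_real.
rewrite ge0_fin_numE; last by apply: integral_ge0 => x _; rewrite lee_fin.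
apply: le_lt_trans (_ : \int[m]_x M%:E < +oo)%E.
  apply: ge0_le_integral => //.
  - by move=> x _ /=; rewrite lee_fin.
  - by move=> x _ /=; rewrite lee_fin.
rewrite integral_cst// lte_mul_pinfty//.
  by rewrite lee_fin (le_trans (phi0 point)).
by rewrite -ge0_fin_numE// fin_num_measure.
Qed.

End borel.

(** Used with a positive inner radius. When [K] moves, the indicator of an annulus
    then converges away from two level sets of the distance, whose volume the
    Steiner formula controls, whereas that of a full outer layer can oscillate on
    the boundary of [K]. *)
Definition annulus {R : realType} {T : metricType R} (K : set T) (a b : R) : set T :=
  [set x | a < dist_set x K <= b].

Section steiner_integrals.
Context {R : realType} {n : nat}.
Notation H := (hyperbolic R n).
Variables (K : set H) (Phi : 'I_n -> {finite_measure set H -> \bar R}).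
Hypotheses (Kb : convex_body K) (KPhi : curvature_measures K Phi).
Implicit Types (a b t : R) (phi : H -> R).

Let K0 : K !=set0 := convex_body_neq0 Kb.
Let K_closed : closed K.
Proof. by case: Kb => cK _ _; apply: compact_closed => //; exact: metric_hausdorff. Qed.

Lemma measurable_parallel_body t : measurable (parallel_body K t).
Proof.
have := continuous_measurable_real (dist_set_continuous K0).
move=> /(_ measurableT `]-oo, t]%classic (measurable_itv _)); rewrite setTI.
by congr measurable; apply/seteqP; split => x /=; rewrite in_itv.
Qed.

Let layer t : set H := parallel_body K t `\` K.

Let measurable_layer t : measurable (layer t).
Proof.
apply: measurableD; first exact: measurable_parallel_body.
exact: closed_measurable_hyp.
Qed.

Let mf : measurable_fun setT (nearest_point K).
Proof. by apply: continuous_measurable_hyp; exact: nearest_point_continuous. Qed.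

Lemma local_parallel_setE t (beta : set H) :
  local_parallel_set K t beta = nearest_point K @^-1` beta `&` layer t.
Proof.
rewrite /local_parallel_set; apply/seteqP; split => x /=.
  by move=> [[]].
move=> [fx [tx Kx]]; split=> //; split=> //.
by have [_ _ /(_ Kx)] := nearest_pointP x Kb.
Qed.

(** On Borel sets the Steiner formula says that the image of the volume of the
    outer parallel layer under the projection is a combination of the curvature
    measures; integrating [phi] against both sides gives the claim. *)
Lemma steiner_layer_integral t phi : 0 < t -> continuous phi -> (forall x, 0 <= phi x) ->
  (\int[@hyp_vol R n]_(x in layer t) (phi (nearest_point K x))%:E =
   \sum_(r < n) (steiner_coef n r t)%:E * \int[Phi r]_x (phi x)%:E)%E.
Proof.
move=> t0 cphi phi0.
have mphi : measurable_fun setT (EFin \o phi).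
  by apply/measurable_EFinP; exact: continuous_measurable_real.
have mphif : measurable_fun setT (EFin \o (phi \o nearest_point K)).
  apply/measurable_EFinP; apply: continuous_measurable_real => x.
  by apply: continuous_comp; [exact: nearest_point_continuous|exact: cphi].
rewrite -(ge0_integral_mrestr _ (measurable_layer t) mphif); last first.
  by move=> x; rewrite lee_fin phi0.
rewrite -(ge0_integral_pushforward mf _ measurableT mphi); last first.
  by move=> x _; rewrite /= lee_fin phi0.
apply: ge0_integral_measure_lincomb => //.
  by move=> r; exact: steiner_coef_ge0.
move=> A mA; rewrite -(KPhi t0 mA) /local_parallel_vol local_parallel_setE.
by [].
Qed.

Lemma measurable_annulus a b : measurable (annulus K a b).
Proof.
rewrite (_ : annulus K a b = parallel_body K b `\` parallel_body K a).
  by apply: measurableD; exact: measurable_parallel_body.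
apply/seteqP; split => x /=; rewrite /annulus /parallel_body/=.
  by move=> /andP[ax xb]; split => //; apply/negP; rewrite -ltNge.
by move=> [xb /negP]; rewrite -ltNge => ->.
Qed.

Lemma annulus_integral a b phi (M : R) : 0 < a -> a < b -> continuous phi ->
  (forall x, 0 <= phi x) -> (forall x, phi x <= M) ->
  (\int[@hyp_vol R n]_(x in annulus K a b) (phi (nearest_point K x))%:E =
   (\sum_(r < n) (steiner_coef n r b - steiner_coef n r a) *
      \int[Phi r]_x phi x)%:E)%E.
Proof.
move=> a0 ab cphi phi0 phiM; have b0 := lt_trans a0 ab.
have mphif : measurable_fun setT (EFin \o (phi \o nearest_point K)).
  apply/measurable_EFinP; apply: continuous_measurable_real => x.
  by apply: continuous_comp; [exact: nearest_point_continuous|exact: cphi].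
have layerE t : 0 < t -> (\int[@hyp_vol R n]_(x in layer t) (phi (nearest_point K x))%:E =
    (\sum_(r < n) steiner_coef n r t * \int[Phi r]_x phi x)%:E)%E.
  move=> t0; rewrite steiner_layer_integral// -sumEFin; apply: eq_bigr => r _.
  rewrite EFinM; congr (_ * _)%E; rewrite /Rintegral fineK//.
  exact: (bounded_integral_fin_num _ cphi phi0 phiM).
have disj : [disjoint layer a & annulus K a b].
  apply/disj_setPS => x [[/= xa _]]; rewrite /annulus/= => /andP[ax _].
  by move: ax; rewrite ltNge xa.
have := layerE b b0; rewrite (_ : layer b = layer a `|` annulus K a b); last first.
  apply/seteqP; split => x; rewrite /layer /parallel_body /annulus/=.
    move=> [xb Kx]; have [xa|ax] := leP (dist_set x K) a; first by left.
    by right.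
  move=> [[xa Kx]|/andP[ax xb]]; first by split => //; apply: le_trans xa (ltW ab).
  split => // /(dist_set_le x); rewrite mdistxx => x0.
  by have := lt_le_trans (lt_trans a0 ax) x0; rewrite ltxx.
rewrite ge0_integral_setU//; last first.
- by move=> x _ /=; rewrite lee_fin.
- exact: measurable_funTS.
- exact: measurable_annulus.
rewrite layerE// => h.
rewrite -[LHS](@addeK _ (\sum_(r < n) steiner_coef n r a * \int[Phi r]_x phi x)%:E _)//.
rewrite addeC in h; rewrite h -EFinB -sumrB; congr (_%:E).
by apply: eq_bigr => r _; rewrite mulrBl.
Qed.

Lemma hyp_vol_annulus a b : 0 < a -> a < b ->
  (@hyp_vol R n (annulus K a b) =
   (\sum_(r < n) (steiner_coef n r b - steiner_coef n r a) * fine (Phi r setT))%:E)%E.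
Proof.
move=> a0 ab; rewrite -[LHS]mul1e -integral_cst; last exact: measurable_annulus.
have c1 : continuous (cst 1 : H -> R) by exact: cst_continuous.
rewrite [LHS](annulus_integral a0 ab c1 (fun=> ler01) (fun=> lexx 1)).
congr (_%:E); apply: eq_bigr => r _.
by rewrite /Rintegral (integral_cst _ _ 1)// mul1e.
Qed.

Lemma measurable_level_set b : measurable [set x | dist_set x K = b].
Proof.
have := continuous_measurable_real (dist_set_continuous K0).
by move=> /(_ measurableT [set b] (measurable_set1 _)); rewrite setTI.
Qed.

(** The Steiner coefficients are continuous in the radius, so thin annuli have
    small volume. *)
Lemma hyp_vol_level_set b : 0 < b -> @hyp_vol R n [set x | dist_set x K = b] = 0%E.
Proof.
move=> b0; apply/eqP; rewrite eq_le measure_ge0 andbT.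
apply/lee_addgt0Pr => e e0; rewrite add0e.
pose G (t : R) := \sum_(r < n) (steiner_coef n r b - steiner_coef n r t) * fine (Phi r setT).
have G0 : G t @[t --> b] --> (0 : R).
  rewrite (_ : 0 = G b); last by rewrite /G big1// => r _; rewrite subrr mul0r.
  apply: cvg_big => [|r _]; first exact: add_continuous.
  apply: cvgM; last exact: cvg_cst.
  apply: cvgB; first exact: cvg_cst.
  exact: continuous_steiner_coef.
have /cvgrPdist_lt/(_ e e0) Ge := cvg_at_left_filter G0.
near b^'- => t.
have t0 : 0 < t by near: t; exact: nbhs_left_gt.
have tb : t < b by near: t; exact: nbhs_left_lt.
have Gte : `|0 - G t| < e by near: t.
apply: le_trans (_ : hyp_vol (annulus K t b) <= _)%E.
  apply: le_measure; rewrite ?inE.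
  - exact: measurable_level_set.
  - exact: measurable_annulus.
  - by move=> x /= xb; rewrite /annulus/= xb lexx tb.
rewrite hyp_vol_annulus// lee_fin -/(G t) ltW// (le_lt_trans (ler_norm _))//.
by rewrite -normrN -sub0r.
Unshelve. all: by end_near. Qed.

End steiner_integrals.

(** * Convergence of the curvature measures *)

Section convergence.
Context {R : realType} {n : nat}.
Notation H := (hyperbolic R n).
Variables (K_ : nat -> set H) (K : set H).
Variables (Phi_ : nat -> 'I_n -> {finite_measure set H -> \bar R}).
Variables (Phi : 'I_n -> {finite_measure set H -> \bar R}).
Hypotheses (Kjb : forall j, convex_body (K_ j)) (Kb : convex_body K).
Hypotheses (KjPhi : forall j, curvature_measures (K_ j) (Phi_ j)).
Hypothesis (KPhi : curvature_measures K Phi).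
Hypothesis KjK : hausdorff_dist (K_ j) K @[j --> \oo] --> (0 : R).

Let K0 : K !=set0 := convex_body_neq0 Kb.
Let Kj0 j : K_ j !=set0 := convex_body_neq0 (Kjb j).

Let nbhd_cvg (r : R) : 0 < r -> \forall j \near \oo,
  K_ j `<=` open_nbhd r K /\ K `<=` open_nbhd r (K_ j).
Proof.
move=> r0; have /cvgrPdist_lt/(_ r r0) h := KjK; near=> j.
have [cK _ _] := Kb; have [cKj _ _] := Kjb j.
apply: hausdorff_dist_lt => //; have : `|0 - hausdorff_dist (K_ j) K| < r by near: j.
by rewrite sub0r normrN => /(le_lt_trans (ler_norm _)).
Unshelve. all: by end_near. Qed.

Let mem_annulus (L : set H) (a b : R) x : (x \in annulus L a b) = (a < dist_set x L <= b).
Proof. by apply/idP/idP; rewrite inE. Qed.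

Lemma near_mem_annulus (a b : R) x : dist_set x K != a -> dist_set x K != b ->
  \forall j \near \oo, (x \in annulus (K_ j) a b) = (x \in annulus K a b).
Proof.
move=> xa xb; have dc := dist_set_cvg (x := x) K0 Kj0 nbhd_cvg.
have gt_near c : c < dist_set x K -> \forall j \near \oo, c < dist_set x (K_ j).
  by move=> cx; exact: (cvgr_gt _ dc).
have lt_near c : dist_set x K < c -> \forall j \near \oo, dist_set x (K_ j) < c.
  by move=> cx; exact: (cvgr_lt _ dc).
have Ha : \forall j \near \oo, (a < dist_set x (K_ j)) = (a < dist_set x K).
  have [ax|xa'|E] := ltgtP a (dist_set x K); last by rewrite E eqxx in xa.
    by near=> j; rewrite (near (gt_near _ ax) j).
  by near=> j; apply/negbTE; rewrite -leNgt ltW// (near (lt_near _ xa') j).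
have Hb : \forall j \near \oo, (dist_set x (K_ j) <= b) = (dist_set x K <= b).
  have [xb'|bx|E] := ltgtP (dist_set x K) b; last by rewrite E eqxx in xb.
    by near=> j; rewrite ltW// (near (lt_near _ xb') j).
  by near=> j; apply/negbTE; rewrite -ltNge (near (gt_near _ bx) j).
by near=> j; rewrite !mem_annulus (near Ha j)// (near Hb j).
Unshelve. all: by end_near. Qed.

(** Dominated convergence. For large [j] all annuli lie in the fixed annulus [E],
    whose volume is finite by the Steiner formula. The indicators converge except
    where the distance to [K] equals one of the two radii. *)
Lemma annulus_integral_cvg (a b M : R) (phi : H -> R) : 0 < a -> a < b ->
  continuous phi -> (forall x, 0 <= phi x) -> (forall x, phi x <= M) ->
  (\int[@hyp_vol R n]_(x in annulus (K_ j) a b) (phi (nearest_point (K_ j) x))%:E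
     @[j --> \oo] -->
   \int[@hyp_vol R n]_(x in annulus K a b) (phi (nearest_point K x))%:E)%E.
Proof.
move=> a0 ab cphi phi0 phiM.
pose E := annulus K (a / 2) (b + 1); have mE : measurable E by exact: measurable_annulus.
have a20 : 0 < a / 2 by lra.
have ab2 : a / 2 < b + 1 by lra.
pose F L : H -> \bar R := (fun x => (phi (nearest_point L x))%:E) \_ (annulus L a b).
have mF L : convex_body L -> measurable_fun E (F L).
  move=> Lb; have mA := measurable_annulus Lb a b.
  apply: measurable_funTS; apply: (measurable_restrictT _ mA).1.
  apply: measurable_funTS; apply/measurable_EFinP; apply: continuous_measurable_real => x.
  by apply: continuous_comp; [exact: nearest_point_continuous|exact: cphi].
have FE L : annulus L a b `<=` E ->
    (\int[@hyp_vol R n]_(x in annulus L a b) (phi (nearest_point L x))%:E =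
     \int[@hyp_vol R n]_(x in E) F L x)%E.
  by move=> LE; rewrite -integral_mkcondr setIidr.
have KE : annulus K a b `<=` E.
  by move=> x; rewrite /E /annulus/= => /andP[ax xb]; apply/andP; split; lra.
have KjE : \forall j \near \oo, annulus (K_ j) a b `<=` E.
  have r0 : 0 < Num.min (a / 2) 1 by rewrite lt_min a20 ltr01.
  near=> j; have [KjKr KKjr] : K_ j `<=` open_nbhd (Num.min (a / 2) 1) K /\
      K `<=` open_nbhd (Num.min (a / 2) 1) (K_ j) by near: j; exact: nbhd_cvg.
  move=> x; rewrite /E /annulus/= => /andP[ax xb].
  have := dist_set_perturb x K0 (Kj0 j) KjKr.
  have := dist_set_perturb x (Kj0 j) K0 KKjr.
  have : Num.min (a / 2) 1 <= a / 2 by rewrite ge_min lexx.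
  have : Num.min (a / 2) 1 <= 1 by rewrite ge_min lexx orbT.
  by move=> h1 h2 h3 h4; apply/andP; split; lra.
(* [E] has finite volume, so a constant is an integrable bound on it. *)
have M0 : 0 <= M by apply: le_trans (phi0 point) (phiM _).
have intM : (@hyp_vol R n).-integrable E (cst M%:E).
  apply/integrableP; split; first exact: measurable_cst.
  rewrite integral_cst//= ger0_norm// lte_mul_pinfty// ?lee_fin//.
  by rewrite (hyp_vol_annulus Kb KPhi a20 ab2) ltry.
have FM L x : (`|F L x| <= M%:E)%E.
  rewrite /F patchE; case: ifP => _; last by rewrite abse0 lee_fin.
  by rewrite gee0_abs lee_fin.
have Fcvg : {ae @hyp_vol R n, forall x, E x -> F (K_ j) x @[j --> \oo] --> F K x}.
  exists ([set x | dist_set x K = a] `|` [set x | dist_set x K = b]); split.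
  - by apply: measurableU; exact: measurable_level_set.
  - have b0 : 0 < b by lra.
    rewrite null_set_setU//; try exact: measurable_level_set;
      exact: (hyp_vol_level_set Kb KPhi).
  move=> x; apply: contra_notP => /not_orP[/eqP xa /eqP xb] _.
  have xj := near_mem_annulus xa xb.
  rewrite /F patchE; case: ifP => xA.
    apply: cvg_trans (_ : (phi (nearest_point (K_ j) x))%:E @[j --> \oo] --> _).
      apply: near_eq_cvg; near=> j; rewrite patchE (near xj j)// xA//.
    apply: cvg_EFin; first by near=> j.
    by apply: continuous_cvg; [exact: cphi|exact: nearest_point_cvg].
  apply: cvg_near_cst; near=> j; rewrite patchE (near xj j)// xA//.
have [_ _] := dominated_convergence mE (fun j => mF _ (Kjb j)) (mF _ Kb) Fcvg intM
  (aeW _ (fun x j _ => FM _ _)).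
rewrite (FE K KE); apply: cvg_trans; apply: near_eq_cvg; near=> j.
by rewrite FE//; near: j.
Unshelve. all: by end_near. Qed.

(** The vectors of coefficients whose combinations of the differences [D j r]
    tend to zero form a subspace [W]. It contains the coefficient vectors of all
    annuli, which no nonzero functional annihilates. *)
Lemma curvature_integral_cvg (phi : H -> R) (M : R) (r : 'I_n) :
  continuous phi -> (forall x, 0 <= phi x) -> (forall x, phi x <= M) ->
  (\int[Phi_ j r]_x (phi x)%:E @[j --> \oo] --> \int[Phi r]_x (phi x)%:E)%E.
Proof.
move=> cphi phi0 phiM.
pose D j r : R := \int[Phi_ j r]_x phi x - \int[Phi r]_x phi x.
pose W (w : 'rV[R]_n) := \sum_(r < n) w 0 r * D j r @[j --> \oo] --> (0 : R).
have Wfull : forall w, W w.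
  apply: separated_subspace_full.
  - rewrite /W (_ : (fun j => _) = (fun=> 0)); first exact: cvg_cst.
    by apply/funext => j; rewrite big1// => s _; rewrite mxE mul0r.
  - move=> c u v Wu Wv; rewrite /W.
    rewrite (_ : (fun j => _) = (fun j => c * \sum_(r < n) u 0 r * D j r +
        \sum_(r < n) v 0 r * D j r)); last first.
      apply/funext => j; rewrite mulr_sumr -big_split; apply: eq_bigr => s _ /=.
      by rewrite !mxE mulrDl mulrA.
    have h := cvgD (cvgM (cvg_cst c) Wu) Wv; rewrite mulr0 addr0 in h; exact: h.
  move=> c Wc; apply/colP => s; rewrite mxE.
  apply: (@steiner_coef_free _ _ (fun s => c s 0)) => t u t0 tu.
  pose w : 'rV[R]_n := \row_s (steiner_coef n s u - steiner_coef n s t).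
  have /Wc/matrixP/(_ 0 0) : W w.
    rewrite /W (_ : (fun j => _) = (fun j =>
      \sum_(s < n) (steiner_coef n s u - steiner_coef n s t) * \int[Phi_ j s]_x phi x -
      \sum_(s < n) (steiner_coef n s u - steiner_coef n s t) * \int[Phi s]_x phi x)); last first.
      by apply/funext => j; rewrite -sumrB; apply: eq_bigr => l _; rewrite mxE mulrBr.
    have := annulus_integral_cvg t0 tu cphi phi0 phiM.
    rewrite (annulus_integral Kb KPhi t0 tu cphi phi0 phiM).
    under eq_cvg => j do rewrite (annulus_integral (Kjb j) (KjPhi j) t0 tu cphi phi0 phiM).
    by move=> /fine_cvgP[_ h]; apply/subr_cvg0; exact: h.
  rewrite !mxE => h; rewrite -[RHS]h; apply: eq_bigr => l _.
  by rewrite mxE mulrC.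
have := Wfull (delta_mx 0 r); rewrite /W.
under eq_cvg => j.
  rewrite (bigD1 r)//= mxE !eqxx mul1r big1 ?addr0 => [|s sr]; last first.
    by rewrite mxE (negbTE sr) andbF mul0r.
  over.
move=> /subr_cvg0 Dr.
have fin (m : {finite_measure set H -> \bar R}) :
    (\int[m]_x (phi x)%:E = (\int[m]_x phi x)%:E)%E.
  by rewrite /Rintegral fineK//; exact: (bounded_integral_fin_num _ cphi phi0 phiM).
rewrite fin (_ : (fun j => _) = (fun j => (\int[Phi_ j r]_x phi x)%:E)); last first.
  by apply/funext => j; rewrite fin.
by apply: cvg_EFin => //; near=> j.
Unshelve. all: by end_near. Qed.

End convergence.

Theorem theorem3 (R : realType) (n : nat) (hn : (2 <= n)%N)
    (K_ : nat -> set (hyperbolic R n)) (K : set (hyperbolic R n))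
    (Phi_ : nat -> 'I_n -> {finite_measure set (hyperbolic R n) -> \bar R})
    (Phi : 'I_n -> {finite_measure set (hyperbolic R n) -> \bar R}) :
  (forall j, convex_body (K_ j)) ->
  convex_body K ->
  (forall j, curvature_measures (K_ j) (Phi_ j)) ->
  curvature_measures K Phi ->
  hausdorff_dist (K_ j) K @[j --> \oo] --> (0 : R) ->
  forall r : 'I_n, weak_cvg (fun j => Phi_ j r) (Phi r).
Proof.
move=> Kjb Kb KjPhi KPhi KjK r phi cphi [M0 [_ bphi]].
(* [curvature_integral_cvg] needs nonnegative functions: it is applied to
   [phi + M] and to the constant [M]. *)
pose M := `|M0| + 1.
have phiM x : `|phi x| <= M.
  by apply: bphi => //; rewrite /M (le_lt_trans (ler_norm _))// ltrDl.
have M0' : 0 <= M by rewrite /M addr_ge0.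
have cM : continuous (cst M : hyperbolic R n -> R) by exact: cst_continuous.
have cpsi : continuous (fun x => phi x + M).
  by move=> x; exact: (@cvgD _ _ _ (nbhs x) _ phi (cst M) _ _ (cphi x) (cM x)).
have psi0 x : 0 <= phi x + M by have := phiM x; rewrite ler_norml; lra.
have psiM x : phi x + M <= M + M by have := phiM x; rewrite ler_norml; lra.
have intphi (m : {finite_measure set (hyperbolic R n) -> \bar R}) :
    m.-integrable setT (EFin \o phi).
  apply: measurable_bounded_integrable => //.
  - by rewrite -ge0_fin_numE// fin_num_measure.
  - exact: continuous_measurable_real.
  - by exists M0; split; [exact: num_real|move=> x xM0 t _; exact: bphi].
have intM (m : {finite_measure set (hyperbolic R n) -> \bar R}) :
    m.-integrable setT (EFin \o cst M) by exact: finite_measure_integrable_cst.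
have finM (m : {finite_measure set (hyperbolic R n) -> \bar R}) :
    (\int[m]_x (cst M x)%:E \is a fin_num)%E.
  exact: (bounded_integral_fin_num _ cM (fun=> M0') (fun=> lexx M)).
have E (m : {finite_measure set (hyperbolic R n) -> \bar R}) :
    (\int[m]_x (phi x)%:E = \int[m]_x (phi x + M)%:E - \int[m]_x (cst M x)%:E)%E.
  rewrite -[LHS](addeK _ (finM m)); congr (_ - _)%E.
  exact/esym/(integralD measurableT (intphi m) (intM m)).
rewrite E; under eq_cvg do rewrite E.
apply: cvgeB.
- by rewrite fin_num_adde_defl// fin_numN.
- exact: (curvature_integral_cvg Kjb Kb KjPhi KPhi KjK cpsi psi0 psiM).
- exact: (curvature_integral_cvg Kjb Kb KjPhi KPhi KjK cM (fun=> M0') (fun=> lexx M)).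
Qed.
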